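(* Let $\ket{\psi}=\sum_{j\in[d]}\alpha_j\ket{j}$ be a quantum state, $\alpha\in\mathbb{C}^d$ its vector of amplitudes, and $U$ a unitary with $U\ket{0}=\ket{\psi}$. Let $q\in[2,\infty]$ and $\varepsilon,\delta\in(0,1)$. Then $$O\Big(\min\Big\{\big(\tfrac3\varepsilon\big)^{\frac{1}{\frac12-\frac1q}},\ \frac{d^{\frac12+\frac1q}}{\varepsilon}\Big\}\log\frac d\delta\Big)$$ applications of controlled-$U$ and controlled-$U^\dagger$ suffice for a quantum algorithm to compute $\tilde\alpha\in\mathbb{C}^d$ with $\|\alpha-\tilde\alpha\|_q\le\varepsilon$, with success probability at least $1-\delta$.
   Context: $\|\cdot\|_q$ is the $\ell_q$-norm. Conventions: $1/\infty=0$, $1/0=\infty$; if a term in the minimum is infinite (e.g., the first term when $q=2$), the bound is the other term. *)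

(* Defs.v *)
From HB Require Import structures.
From mathcomp Require Import all_boot all_order all_algebra.
From mathcomp Require Import all_classical all_reals all_analysis.
From mathcomp Require Import complex.

Set Implicit Arguments.
Unset Strict Implicit.
Unset Printing Implicit Defensive.

Import Order.TTheory GRing.Theory Num.Theory.
Local Open Scope ring_scope.

Section QDefs.
Variable R : realType.
Local Notation C := (R[i]).

Definition cabs (z : C) : R := ComplexField.Normc.normc z.

Definition cconj (z : C) : C := conjc z.

Definition invq (q : \bar R) : R :=
  match q with EFin r => r^-1 | _ => 0 end.

Definition lq_dist (d : nat) (q : \bar R) (a b : 'I_d -> C) : R :=
  match q with
  | EFin r => (\sum_(j < d) (cabs (a j - b j)) `^ r) `^ (r^-1)
  | _ => \big[Num.max/0]_(j < d) cabs (a j - b j)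
  end.

Definition qop (T : finType) := T -> T -> C.

Definition unitary_op (T : finType) (A : qop T) : Prop :=
  forall i j : T, \sum_(l : T) cconj (A l i) * A l j = (i == j)%:R.

(* workspace of a query algorithm: control qubit x system register C^d
   x ancilla register C^k *)
Definition qspace (d k : nat) := ('I_2 * 'I_d * 'I_k)%type.

Definition ctrlU (d k : nat) (b : bool) (U : qop 'I_d)
  : qop (qspace d k) :=
  fun s t =>
    let: (c, x, a) := s in let: (c', x', a') := t in
    if (a == a') && (c == c') then
      (if nat_of_ord c == 1%N then
         (if b then U x x' else cconj (U x' x))
       else (x == x')%:R)
    else 0.

(* A quantum query algorithm with oracle access to controlled-U and
   controlled-U^dagger: start in basis state qs0, apply V 0, then for
   t = 1..qnq apply the query ctrlU (qdir t) U followed by V t; finally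
   measure in the computational basis and output qout s on outcome s. *)
Record query_algo (d k : nat) := QueryAlgo {
  qnq : nat;
  qs0 : qspace d k;
  qdir : nat -> bool;
  qV : nat -> qop (qspace d k);
  qout : qspace d k -> ('I_d -> C)
}.

Fixpoint run_state (d k : nat) (A : query_algo d k) (U : qop 'I_d)
  (n : nat) : qspace d k -> C :=
  match n with
  | 0%N => fun s => qV A 0 s (qs0 A)
  | n'.+1 => fun s =>
      \sum_(l : qspace d k) qV A n'.+1 s l *
        \sum_(m : qspace d k) @ctrlU d k (qdir A n'.+1) U l m * run_state A U n' m
  end.

Definition final_state d k (A : query_algo d k) (U : qop 'I_d) :=
  run_state A U (qnq A).

Definition success_prob d k (A : query_algo d k) (U : qop 'I_d)
  (q : \bar R) (eps : R) (alpha : 'I_d -> C) : R :=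
  \sum_(s : qspace d k | lq_dist q alpha (qout A s) <= eps)
     (cabs (final_state A U s)) ^+ 2.

(* the query bound  min{(3/eps)^(1/(1/2-1/q)), d^(1/2+1/q)/eps} log(d/delta),
   where the first term is +oo (so omitted) when q = 2 *)
Definition query_bound (d : nat) (q : \bar R) (eps delta : R) : R :=
  let t2 := (d%:R) `^ (2^-1 + invq q) / eps in
  let m := if q == 2%:E then t2
           else Num.min ((3 / eps) `^ ((2^-1 - invq q)^-1)) t2 in
  m * ln (d%:R / delta).

End QDefs.

(* Main.v *)
(* Everything reduces to estimating the amplitudes in the sup norm: an l_q error is at
   most d^(1/q) times the sup error, and at most 2 t^(1 - 2/q) if the sup error is t and
   both vectors lie in the unit ball.

   With O(log(d/delta)/eps^2) copies of the state one measures frequencies in the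
   computational basis, and then interferes the state with the reference whose amplitudes
   are the square roots of these frequencies: the variance of each contrast is
   proportional to the reference probability, so that every non-negligible amplitude is
   found to precision eps.

   With an estimate e of sup error eta/sqrt d, put psi' = (|0>|0> + |1>|psi>)/sqrt 2 and
   let phi be the normalization of |0>|0> + |1>|e>.  The reflection about psi' costs two
   queries, and p ~ 1/eta rounds of amplitude amplification magnify the component of psi'
   orthogonal to phi to constant size.  O(d log(d/delta)) such states then determine it up
   to 1/sqrt d in the sup norm, which halves the error of e; the known first component
   |0>|0> eliminates the unknown overlap <phi, psi'>, global phase included.  The costs
   p d log(d/delta) of the successive halvings add up geometrically to
   O(sqrt d/eps log(d/delta)).

   When d = 1 and delta is close to 1 the logarithm is small, and a coarser estimate
   followed by a random guess among the arcs of the unit circle close to it suffices. *)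
Require Import Defs.
From HB Require Import structures.
From mathcomp Require Import all_boot all_order all_algebra.
From mathcomp Require Import all_classical all_reals all_analysis.
From mathcomp Require Import complex.
From mathcomp Require Import ring lra.

Set Implicit Arguments.
Unset Strict Implicit.
Unset Printing Implicit Defensive.

Import Order.TTheory GRing.Theory Num.Theory.
Local Open Scope ring_scope.
Local Notation Re := complex.Re.
Local Notation Im := complex.Im.
Local Notation invq := Defs.invq.
Local Notation ind b := (nat_of_bool b)%:R.

(** * Complex numbers, vectors and reflections *)

(** A [query_algo] measures once, at the end, and its number of queries is fixed in advance, whereas
    the estimation is adaptive: frequencies choose a reference state, an estimate chooses a
    reflection. Programs therefore depend on earlier outcomes through their gates alone, and the
    register of a finished stage stays in the ancilla, from where it controls the next stage.
    Failure probabilities then become iterated expectations. Typical amplitudes have size 1/sqrt d,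
    so a deviation bound that knew only the range of a contrast would lose powers of d. All bounds
    go through the second moment, which is at most 5/2 a^2 once the reference amplitude a and the
    measured amplitude B satisfy |B|^2 <= 4 a^2. Dividing the mean contrast by a then leaves an
    error independent of a. Both reference states are built to meet this condition. The amplitudes
    are wanted with their global phase. It is observable because the control gives access to a
    branch on which [U] does not act, and this branch provides the phase reference. *)

Section Complex.
Variable R : realType.
Local Notation C := R[i].
Implicit Types (z w : C) (r : R).

Definition sqn z : R := Re z ^+ 2 + Im z ^+ 2.

Lemma sqn_ge0 z : 0 <= sqn z.
Proof. by rewrite addr_ge0 // sqr_ge0. Qed.

Lemma sqn0 : sqn 0 = 0.
Proof. by rewrite /sqn /= expr0n /= addr0. Qed.

Lemma sqn1 : sqn 1 = 1.
Proof. by rewrite /sqn /= expr1n expr0n /= addr0. Qed.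

Lemma sqn_eq0 z : sqn z = 0 -> z = 0.
Proof.
case: z => a b; rewrite /sqn /= => /eqP.
by rewrite paddr_eq0 ?sqr_ge0 // !sqrf_eq0 => /andP[/eqP -> /eqP ->].
Qed.

Lemma sqnM z w : sqn (z * w) = sqn z * sqn w.
Proof. by case: z w => [a b] [c e]; rewrite /sqn /=; ring. Qed.

Lemma sqnJ z : sqn (conjc z) = sqn z.
Proof. by case: z => a b; rewrite /sqn /= sqrrN. Qed.

Lemma conjcM z w : conjc (z * w) = conjc z * conjc w.
Proof. exact: rmorphM. Qed.

Lemma conjcN z : conjc (- z) = - conjc z.
Proof. exact: rmorphN. Qed.

Lemma conjc_sum (J : Type) (r : seq J) (P : pred J) (F : J -> C) :
  conjc (\sum_(j <- r | P j) F j) = \sum_(j <- r | P j) conjc (F j).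
Proof. exact: rmorph_sum. Qed.

Lemma conjcD z w : conjc (z + w) = conjc z + conjc w.
Proof. exact: rmorphD. Qed.

Lemma conjcB z w : conjc (z - w) = conjc z - conjc w.
Proof. exact: rmorphB. Qed.

Lemma sqnN z : sqn (- z) = sqn z.
Proof. by case: z => a b; rewrite /sqn /= !sqrrN. Qed.

Lemma sqnR r : sqn (r%:C)%C = r ^+ 2.
Proof. by rewrite /sqn /= expr0n /= addr0. Qed.

Lemma conjcMz z : conjc z * z = ((sqn z)%:C)%C.
Proof.
case: z => a b; rewrite /sqn /=; apply/eqP; rewrite eq_complex /=.
by apply/andP; split; apply/eqP; ring.
Qed.

Lemma cabs_sqrt z : cabs z = Num.sqrt (sqn z).
Proof. by case: z. Qed.

Lemma cabs_sqr z : cabs z ^+ 2 = sqn z.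
Proof. by rewrite cabs_sqrt sqr_sqrtr // sqn_ge0. Qed.

Lemma cabs_ge0 z : 0 <= cabs z.
Proof. by rewrite cabs_sqrt sqrtr_ge0. Qed.

Lemma cabsM z w : cabs (z * w) = cabs z * cabs w.
Proof. exact: ComplexField.Normc.normcM. Qed.

Lemma cabsN z : cabs (- z) = cabs z.
Proof. by rewrite !cabs_sqrt sqnN. Qed.

Lemma cabsD z w : cabs (z + w) <= cabs z + cabs w.
Proof. exact: le_normcD. Qed.

Lemma cabsB z w : cabs (z - w) = cabs (w - z).
Proof. by rewrite -cabsN opprB. Qed.

Lemma cabsR r : cabs (r%:C)%C = `|r|.
Proof. by rewrite cabs_sqrt sqnR sqrtr_sqr. Qed.

Lemma cabs_leP z r : 0 <= r -> (cabs z <= r) = (sqn z <= r ^+ 2).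
Proof. by move=> r0; rewrite -cabs_sqr ler_pXn2r // nnegrE cabs_ge0. Qed.

Lemma cabs_Re z : `|Re z| <= cabs z.
Proof.
rewrite -(ler_pXn2r (_ : 0 < 2)%N) ?nnegrE ?cabs_ge0 //.
by rewrite cabs_sqr real_normK ?num_real // /sqn lerDl sqr_ge0.
Qed.

Lemma cabs_Im z : `|Im z| <= cabs z.
Proof.
rewrite -(ler_pXn2r (_ : 0 < 2)%N) ?nnegrE ?cabs_ge0 //.
by rewrite cabs_sqr real_normK ?num_real // /sqn lerDr sqr_ge0.
Qed.

Lemma cabs_ReIm z : cabs z <= `|Re z| + `|Im z|.
Proof.
rewrite cabs_leP ?addr_ge0 // sqrrD !real_normK ?num_real // /sqn.
have : 0 <= `|Re z| * `|Im z| by rewrite mulr_ge0.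
lra.
Qed.

Lemma sqnD_le z w : sqn (z + w) <= 2 * sqn z + 2 * sqn w.
Proof.
case: z w => [a b] [c e]; rewrite /sqn /=.
have := sqr_ge0 (a - c); have := sqr_ge0 (b - e); nra.
Qed.

(** Two branches [z / sqrt 2] and [w / sqrt 2] recombined by a Hadamard gate give the outcomes + and
    - with probabilities [|z + w|^2 / 4] and [|z - w|^2 / 4]; this is the mean of their sign. *)
Lemma sqn_interfere_diff z w :
  sqn (z + w) / 4 - sqn (z - w) / 4 = Re (conjc z * w).
Proof. by case: z w => [a b] [c e]; rewrite /sqn /=; field. Qed.

Lemma sqn_interfere_sum z w :
  sqn (z + w) / 4 + sqn (z - w) / 4 = (sqn z + sqn w) / 2.
Proof. by case: z w => [a b] [c e]; rewrite /sqn /=; field. Qed.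

End Complex.

Section Vectors.
Variable R : realType.
Local Notation C := R[i].
Variable T : finType.
Implicit Types (u v w : T -> C) (c : C).

Definition ip u v : C := \sum_t conjc (u t) * v t.
Definition nrm2 v : R := \sum_t sqn (v t).
Definition basis (e : T) : T -> C := fun s => (s == e)%:R.

Lemma nrm2_ge0 v : 0 <= nrm2 v.
Proof. by apply: sumr_ge0 => t _; exact: sqn_ge0. Qed.

Lemma ip_nrm2 v : ip v v = ((nrm2 v)%:C)%C.
Proof. by rewrite /nrm2 rmorph_sum; apply: eq_bigr => t _; rewrite conjcMz. Qed.

Lemma ipC u v : conjc (ip u v) = ip v u.
Proof.
by rewrite /ip rmorph_sum; apply: eq_bigr => t _; rewrite rmorphM /= conjcK mulrC.
Qed.

Lemma ipDr c u v w : ip u (fun t => c * v t + w t) = c * ip u v + ip u w.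
Proof.
rewrite /ip mulr_sumr -big_split /=; apply: eq_bigr => t _; ring.
Qed.

Lemma ipDl c u v w : ip (fun t => c * v t + w t) u = conjc c * ip v u + ip w u.
Proof. by rewrite -ipC ipDr rmorphD rmorphM /= !ipC. Qed.

Lemma ip_basis e v : ip (basis e) v = v e.
Proof.
rewrite /ip (bigD1 e) //= /basis eqxx conjc1 mul1r big1 ?addr0 // => t te.
by rewrite (negbTE te) conjc0 mul0r.
Qed.

Lemma ip_basisr e v : ip v (basis e) = conjc (v e).
Proof. by rewrite -ipC ip_basis. Qed.

Lemma nrm2_basis e : nrm2 (basis e) = 1.
Proof.
rewrite /nrm2 (bigD1 e) //= /basis eqxx sqn1 big1 ?addr0 // => t te.
by rewrite (negbTE te) sqn0.
Qed.

Lemma nrm2_eq0 v : nrm2 v = 0 -> v = fun=> 0.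
Proof.
move=> /eqP; rewrite psumr_eq0 => [/allP h|t _]; last exact: sqn_ge0.
by apply/funext => t; apply/sqn_eq0/eqP/h; rewrite mem_index_enum.
Qed.

Lemma nrm2Z c v : nrm2 (fun t => c * v t) = sqn c * nrm2 v.
Proof. by rewrite /nrm2 mulr_sumr; apply: eq_bigr => t _; rewrite sqnM. Qed.

Lemma nrm2D c u v : nrm2 (fun t => c * u t + v t) =
  sqn c * nrm2 u + 2 * Re (conjc c * ip u v) + nrm2 v.
Proof.
have -> : Re (conjc c * ip u v) = \sum_t Re (conjc c * (conjc (u t) * v t)).
  by rewrite /ip mulr_sumr (raddf_sum (@Re R)).
rewrite /nrm2 !mulr_sumr -!big_split /=; apply: eq_bigr => t _.
by case: c (u t) (v t) => [a b] [p q] [r s]; rewrite /sqn /=; ring.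
Qed.

(* Gates are handled as linear maps; in finite dimension these are the unitary ones. *)
Definition isometry (A : (T -> C) -> (T -> C)) :=
  (forall c u v, A (fun t => c * u t + v t) = (fun t => c * A u t + A v t)) /\
  (forall u v, ip (A u) (A v) = ip u v).

Lemma isometry_id : isometry id.
Proof. by []. Qed.

Lemma isometry_comp A B : isometry A -> isometry B -> isometry (A \o B).
Proof.
by move=> [lA iA] [lB iB]; split=> [c u v|u v]; rewrite /= ?lB ?lA ?iA ?iB.
Qed.

Lemma isometry_nrm2 A v : isometry A -> nrm2 (A v) = nrm2 v.
Proof. by move=> [_ iA]; apply: complexI; rewrite -!ip_nrm2 iA. Qed.

Lemma isometryZ A c v : isometry A -> A (fun t => c * v t) = (fun t => c * A v t).
Proof.
move=> [lA _].
have A0 : A (fun=> 0) = fun=> 0.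
  have := lA (-1) (fun=> 0) (fun=> 0).
  have -> : (fun t : T => -1 * (0 : C) + 0) = fun=> 0.
    by apply/funext => t; rewrite mulr0 addr0.
  by move=> ->; apply/funext => t; rewrite mulN1r addNr.
have -> : (fun t => c * v t) = (fun t => c * v t + (fun=> 0) t).
  by apply/funext => t; rewrite addr0.
by rewrite lA A0; apply/funext => t; rewrite addr0.
Qed.

Lemma isometry_expand A v s : isometry A ->
  A v s = \sum_t A (basis t) s * v t.
Proof.
move=> iA.
have E (r : seq T) : A (fun s => \sum_(t <- r) v t * basis t s) =
    fun s => \sum_(t <- r) v t * A (basis t) s.
  elim: r => [|t r IH].
    have -> : (fun s : T => \sum_(t <- [::]) v t * basis t s) = fun s => 0 * v s.
      by apply/funext => x; rewrite big_nil mul0r.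
    by rewrite isometryZ //; apply/funext => x; rewrite big_nil mul0r.
  transitivity (A (fun s => v t * basis t s + \sum_(j <- r) v j * basis j s)).
    by congr A; apply/funext => x; rewrite big_cons.
  by rewrite iA.1 IH; apply/funext => x; rewrite big_cons.
have {1}-> : v = (fun s => \sum_(t <- index_enum T) v t * basis t s).
  apply/funext => x; rewrite (bigD1 x) //= /basis eqxx mulr1 big1 ?addr0 //.
  by move=> t tx; rewrite eq_sym (negbTE tx) mulr0.
by rewrite E; apply: eq_bigr => t _; rewrite mulrC.
Qed.

Lemma isometry_unitary A : isometry A -> unitary_op (fun s t => A (basis t) s).
Proof.
by move=> [_ iA] i j; have := iA (basis i) (basis j); rewrite ip_basis.
Qed.

Lemma isometry_reindex (f : T -> T) : injective f -> isometry (fun v s => v (f s)).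
Proof.
move=> fI; split=> // u v.
by rewrite /ip [RHS](reindex_inj fI).
Qed.

Lemma isometry_mx (M : qop R T) :
  unitary_op M -> isometry (fun v s => \sum_t M s t * v t).
Proof.
move=> Mu; split=> [c u v|u v].
  apply/funext => s; rewrite mulr_sumr -big_split /=; apply: eq_bigr => t _; ring.
have E s : conjc (\sum_t M s t * u t) * (\sum_t M s t * v t) =
    \sum_t \sum_t' conjc (u t) * v t' * (conjc (M s t) * M s t').
  rewrite conjc_sum mulr_suml; apply: eq_bigr => t _.
  by rewrite mulr_sumr; apply: eq_bigr => t' _; rewrite conjcM; ring.
rewrite /ip (eq_bigr _ (fun s _ => E s)) exchange_big; apply: eq_bigr => t _ /=.
rewrite exchange_big (bigD1 t) //= [X in _ + X]big1 ?addr0 => [|t' t't].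
  by rewrite -mulr_sumr [X in _ * X]Mu eqxx mulr1.
by rewrite -mulr_sumr [X in _ * X]Mu eq_sym (negbTE t't) mulr0.
Qed.

(** Householder reflection with the normalization built in. At [w = 0] the convention [2 / 0 = 0]
    makes it the identity, so it is an isometry for every [w]. *)
Definition refl w v : T -> C :=
  fun s => v s - ((2 / nrm2 w)%:C)%C * ip w v * w s.

Lemma refl_add w v : refl w v = fun s => - (((2 / nrm2 w)%:C)%C * ip w v) * w s + v s.
Proof. by apply/funext => s; rewrite /refl mulNr addrC. Qed.

Lemma isometry_refl w : isometry (refl w).
Proof.
split=> [c u v|u v].
  by apply/funext => s; rewrite /refl ipDr; ring.
rewrite !refl_add ipDr !ipDl ip_nrm2.
set k : R := 2 / nrm2 w.
rewrite conjcN conjcM conjc_real ipC.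
set a := ip u w; set b := ip w v.
have [w0|w0] := eqVneq (nrm2 w) 0.
  have k0 : k = 0 by rewrite /k w0 invr0 mulr0.
  by rewrite k0 !(mul0r, oppr0, mulr0, add0r).
have -> : nrm2 w = 2 / k by rewrite /k; field.
have kC : (k%:C)%C != 0 :> C.
  by rewrite eq_complex /= eqxx andbT /k mulf_neq0 ?invr_eq0.
have -> : ((2 / k)%:C)%C = 2 / (k%:C)%C.
  by rewrite rmorphM fmorphV /= rmorph_nat.
by field.
Qed.

(** A real [v e] makes [basis e - v] orthogonal to [basis e + v], so the reflection exchanges these
    two unit vectors. A single gate thus prepares any state that has a real amplitude at the initial
    label. *)
Lemma refl_basis e v : nrm2 v = 1 -> Im (v e) = 0 ->
  refl (fun s => basis e s - v s) (basis e) = v.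
Proof.
move=> v1 ve; set w := fun s => basis e s - v s.
have wE : w = fun s => -1 * v s + basis e s.
  by apply/funext => s; rewrite /w mulN1r addrC.
have ipw : ip w (basis e) = ((1 - Re (v e))%:C)%C.
  rewrite ip_basisr /w /basis eqxx; case: (v e) ve => a b /= ->.
  by apply/eqP; rewrite eq_complex /= !subr0 oppr0 !eqxx.
have nw : nrm2 w = 2 * (1 - Re (v e)).
  rewrite wE nrm2D v1 nrm2_basis sqnN sqn1 ip_basisr.
  by case: (v e) ve => a b /= ->; ring.
rewrite /refl ipw nw.
have [w0|w0] := eqVneq (1 - Re (v e)) 0.
  have /nrm2_eq0 wz : nrm2 w = 0 by rewrite nw w0 mulr0.
  apply/funext => s; have := congr1 (fun f => f s) wz; rewrite /w => /eqP.
  by rewrite subr_eq0 => /eqP ->; rewrite subrr mulr0 subr0.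
apply/funext => s.
rewrite -rmorphM /= (_ : 2 / _ * _ = 1) ?mul1r /w ?subKr //.
by field.
Qed.

End Vectors.

(** * Query programs and their sequential composition *)

Section Programs.
Variables (R : realType) (d : nat).
Local Notation C := R[i].
Local Notation base := ('I_2 * 'I_d)%type.

(** The shape of [qspace], but with any finite type as ancilla, so that programs compose by forming
    products of ancillas; ordinals return only in [compile]. *)
Definition reg (K : finType) : finType := (base * K)%type.

Lemma sum_reg (V : nmodType) (K : finType) (F : reg K -> V) :
  \sum_s F s = \sum_(c : 'I_2) \sum_(a : K) \sum_(x : 'I_d) F (c, x, a).
Proof.
under [RHS]eq_bigr => c _ do rewrite exchange_big /=.
rewrite (pair_bigA _ (fun c x => \sum_a F (c, x, a))) /=.
rewrite (pair_bigA _ (fun p a => F (p.1, p.2, a))) /=.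
by apply: eq_bigr => -[[c x] a].
Qed.

Section Oracle.
Variable U : qop R 'I_d.

Definition oracle (b : bool) : qop R 'I_d :=
  fun x y => if b then U x y else conjc (U y x).

(** [unitary_op] speaks of columns. A left inverse of a square matrix is also a right inverse, which
    gives the rows and with them the unitarity of the inverse oracle. *)
Lemma unitary_rows : unitary_op U ->
  forall i j, \sum_l U i l * conjc (U j l) = (i == j)%:R.
Proof.
move=> Uu; pose M := \matrix_(i, j) U i j; pose N := \matrix_(i, j) conjc (U j i).
have NM : N *m M = 1%:M.
  apply/matrixP => i j; rewrite !mxE -Uu; apply: eq_bigr => l _; by rewrite !mxE.
move=> i j; have /matrixP/(_ i j) := mulmx1C NM; rewrite !mxE => <-.
by apply: eq_bigr => l _; rewrite !mxE.
Qed.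

Lemma unitary_oracle b : unitary_op U -> unitary_op (oracle b).
Proof.
move=> Uu; case: b => // i j; rewrite -unitary_rows //.
by apply: eq_bigr => l _; rewrite /cconj /oracle conjcK.
Qed.

Definition query (K : finType) b (v : reg K -> C) : reg K -> C := fun s =>
  if s.1.1 == 1%N :> nat then \sum_x oracle b s.1.2 x * v (s.1.1, x, s.2) else v s.

Lemma isometry_query K b : unitary_op U -> isometry (@query K b).
Proof.
move=> /(@unitary_oracle b) Mu; split=> [c u v|u v].
  apply/funext => s; rewrite /query; case: ifP => // _.
  rewrite mulr_sumr -big_split /=; apply: eq_bigr => x _; ring.
rewrite /ip !sum_reg; apply: eq_bigr => c _; apply: eq_bigr => a _.
rewrite /query /=; case: (nat_of_ord c == 1)%N => //.
exact: (isometry_mx Mu).2 (fun x => u (c, x, a)) (fun x => v (c, x, a)).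
Qed.

Lemma query_inv K (v : reg K -> C) : unitary_op U -> query true (query false v) = v.
Proof.
move=> Uu; apply/funext => s; rewrite /query /=.
case c1: (nat_of_ord s.1.1 == 1)%N => //.
under eq_bigr => x _ do rewrite mulr_sumr.
rewrite exchange_big /= (bigD1 s.1.2) //= [X in _ + X]big1 ?addr0.
  under eq_bigr => x _ do rewrite mulrA.
  by rewrite -mulr_suml unitary_rows // eqxx mul1r; case: s c1 => [[]].
move=> y ys; under eq_bigr => x _ do rewrite mulrA.
by rewrite -mulr_suml unitary_rows // eq_sym (negbTE ys) mul0r.
Qed.

End Oracle.

(* A family of programs sharing one query schedule: only the gates depend on the
   parameter [i : I], which holds the outcomes of earlier measurements. *)
Inductive op (I : Type) (K : finType) : Type :=
  | Gate of (I -> (reg K -> C) -> (reg K -> C))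
  | Query of bool.
Arguments Query {I K}.

Definition wf_op I K (o : op I K) :=
  if o is Gate A then forall i, isometry (A i) else True.

Fixpoint wf_ops I K (l : seq (op I K)) :=
  if l is o :: l' then wf_op o /\ wf_ops l' else True.

Lemma wf_cat I K (l1 l2 : seq (op I K)) : wf_ops l1 -> wf_ops l2 -> wf_ops (l1 ++ l2).
Proof. by elim: l1 => //= o l1 IH [? /IH h] /h. Qed.

Definition is_query I K (o : op I K) := if o is Query _ then true else false.

Definition step I K (i : I) U (v : reg K -> C) (o : op I K) :=
  match o with Gate A => A i v | Query b => query U b v end.

Definition run I K (i : I) U (l : seq (op I K)) v := foldl (step i U) v l.

Lemma isometry_run I K (i : I) U (l : seq (op I K)) :
  unitary_op U -> wf_ops l -> isometry (run i U l).
Proof.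
move=> Uu; elim: l => [|o l IH] /= wl; first exact: isometry_id.
apply: (@isometry_comp _ _ (run i U l) (step i U ^~ o)); first exact/IH/wl.2.
by case: o wl => [A [h _]|b _] /=; [exact: h|exact: isometry_query].
Qed.

Record expt (I : Type) (O : finType) := Expt {
  anc : finType;
  init : reg anc;
  ops : seq (op I anc);
  out : reg anc -> O;
  wf_expt : wf_ops ops
}.

Section Expectation.
Variables (I : Type) (O : finType) (X : expt I O).
Implicit Types (i : I) (f g : O -> R).

Definition nq := count (@is_query I (anc X)) (ops X).

Definition amp i U := run i U (ops X) (basis R (init X)).

Definition Ex i U f : R := \sum_s sqn (amp i U s) * f (out s).

Lemma eq_Ex i U f g : f =1 g -> Ex i U f = Ex i U g.
Proof. by move=> fg; apply: eq_bigr => s _; rewrite fg. Qed.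

Lemma Ex_le i U f g : (forall o, f o <= g o) -> Ex i U f <= Ex i U g.
Proof. by move=> fg; apply: ler_sum => s _; rewrite ler_wpM2l // sqn_ge0. Qed.

Lemma ExD i U f g : Ex i U (fun o => f o + g o) = Ex i U f + Ex i U g.
Proof. by rewrite -big_split; apply: eq_bigr => s _; rewrite mulrDr. Qed.

Lemma ExZ i U (c : R) f : Ex i U (fun o => c * f o) = c * Ex i U f.
Proof. by rewrite /Ex mulr_sumr; apply: eq_bigr => s _; rewrite mulrCA. Qed.

Lemma Ex_sum i U (J : finType) (P : pred J) (F : J -> O -> R) :
  Ex i U (fun o => \sum_(j | P j) F j o) = \sum_(j | P j) Ex i U (F j).
Proof.
by rewrite exchange_big; apply: eq_bigr => s _; rewrite mulr_sumr.
Qed.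

Lemma Ex_cst i U (c : R) : unitary_op U -> Ex i U (fun=> c) = c.
Proof.
move=> Uu; rewrite /Ex -mulr_suml.
have -> : \sum_s sqn (amp i U s) = nrm2 (amp i U) by [].
by rewrite isometry_nrm2 ?nrm2_basis ?mul1r //; apply: isometry_run => //; exact: wf_expt.
Qed.

End Expectation.
Arguments amp {I O} X i U _.

Definition emap I (O O' : finType) (g : O -> O') (X : expt I O) : expt I O' :=
  @Expt I O' (anc X) (init X) (ops X) (g \o @out I O X) (wf_expt X).

Lemma nq_emap I (O O' : finType) (g : O -> O') (X : expt I O) : nq (emap g X) = nq X.
Proof. by []. Qed.

Lemma Ex_emap I (O O' : finType) (g : O -> O') (X : expt I O) i U f :
  Ex (emap g X) i U f = Ex X i U (f \o g).
Proof. by []. Qed.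

Section Lift.
Variables (I J : Type) (K K1 L : finType).
Variables (mk : reg K1 -> L -> reg K) (pr : reg K -> reg K1) (rs : reg K -> L).
Hypothesis mkK : forall s, mk (pr s) (rs s) = s.
Hypothesis prK : forall t l, pr (mk t l) = t.
Hypothesis rsK : forall t l, rs (mk t l) = l.
Hypothesis mk1 : forall t l, (mk t l).1 = t.1.
Hypothesis mkx : forall t l c x, (c, x, (mk t l).2) = mk (c, x, t.2) l.
Variable h : I -> L -> J.

(** [mk] glues the register of a program to a spectator part [L], which is read through [h] but
    never changed: the lifted gate is block diagonal over [L]. By [mk1] and [mkx] the queried pair
    stays in front, where the oracle acts. *)
Definition lift_op (o : op J K1) : op I K :=
  match o with
  | Gate A => Gate (fun i v s => A (h i (rs s)) (fun t => v (mk t (rs s))) (pr s))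
  | Query b => Query b
  end.

Lemma step_lift i U v o l :
  (fun t => step i U v (lift_op o) (mk t l)) =
  step (h i l) U (fun t => v (mk t l)) o.
Proof.
case: o => [A|b] /=; apply/funext => t; first by rewrite prK rsK.
rewrite /query mk1; case: ifP => // _.
by apply: eq_bigr => x _; rewrite mkx.
Qed.

Lemma run_lift i U l v s :
  run i U (map lift_op l) v s =
  run (h i (rs s)) U l (fun t => v (mk t (rs s))) (pr s).
Proof.
elim: l v => [|o l IH] v /=; first by rewrite mkK.
by rewrite IH step_lift.
Qed.

Lemma wf_lift l : wf_ops l -> wf_ops (map lift_op l).
Proof.
elim: l => //= o l IH [wo /IH]; split=> //; case: o wo => //= A iA i.
have sumL (F : reg K -> C) : \sum_s F s = \sum_l \sum_t F (mk t l).
  rewrite pair_bigA /= (reindex (fun p : L * reg K1 => mk p.2 p.1)) //=.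
  exists (fun s => (rs s, pr s)) => [[l' t] _|s _] /=; first by rewrite prK rsK.
  exact: mkK.
split=> [c u v|u v]; first by apply/funext => s; rewrite (iA _).1.
rewrite /ip !sumL; apply: eq_bigr => l' _.
rewrite -[RHS](iA (h i l')).2; apply: eq_bigr => t _; by rewrite prK rsK.
Qed.

Lemma nq_lift l : count (@is_query I K) (map lift_op l) = count (@is_query J K1) l.
Proof. by elim: l => //= -[A|b] l ->. Qed.

End Lift.

Definition reparam_op I J K (h : J -> I) (o : op I K) : op J K :=
  match o with Gate A => Gate (fun j => A (h j)) | Query b => Query b end.

Lemma wf_reparam I J K (h : J -> I) (l : seq (op I K)) :
  wf_ops l -> wf_ops (map (reparam_op h) l).
Proof.
elim: l => //= o l IH [wo /IH]; split=> //.
by case: o wo => //= A iA j; exact: iA.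
Qed.

Definition reparam I J (h : J -> I) (O : finType) (X : expt I O) : expt J O :=
  @Expt J O (anc X) (init X) (map (reparam_op h) (ops X)) (@out _ _ X)
    (wf_reparam h (wf_expt X)).

Lemma nq_reparam I J (h : J -> I) (O : finType) (X : expt I O) : nq (reparam h X) = nq X.
Proof. by rewrite /nq /=; elim: (ops X) => //= -[A|b] l ->. Qed.

Lemma Ex_reparam I J (h : J -> I) (O : finType) (X : expt I O) j U f :
  Ex (reparam h X) j U f = Ex X (h j) U f.
Proof.
rewrite /Ex /amp /=; apply: eq_bigr => s _; congr (sqn _ * _).
by rewrite /run; elim: (ops X) (basis _ _) => //= -[A|b] l IH v; rewrite IH.
Qed.

Section Bind.
Variables (I : Type) (O1 O2 : finType) (X : expt I O1) (Y : expt (I * O1) O2).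

(* The first program runs with the working register in front; the register is
   then swapped into a slot of the ancilla, and the second program runs
   controlled by what is stored there. *)
Let K : finType := (anc X * base * anc Y)%type.
Let mkX (t : reg (anc X)) (l : base * anc Y) : reg K := (t.1, (t.2, l.1, l.2)).
Let prX (s : reg K) : reg (anc X) := (s.1, s.2.1.1).
Let rsX (s : reg K) : base * anc Y := (s.2.1.2, s.2.2).
Let mkY (t : reg (anc Y)) (l : anc X * base) : reg K := (t.1, (l.1, l.2, t.2)).
Let prY (s : reg K) : reg (anc Y) := (s.1, s.2.2).
Let rsY (s : reg K) : anc X * base := (s.2.1.1, s.2.1.2).
Let hY (i : I) (l : anc X * base) : I * O1 := (i, out (e := X) (l.2, l.1)).
Let swp (s : reg K) : reg K := (s.2.1.2, (s.2.1.1, s.1, s.2.2)).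

Let bind_ops : seq (op I K) :=
  map (lift_op mkX prX rsX (fun i _ => i)) (ops X) ++
  Gate (fun _ v s => v (swp s)) ::
  map (lift_op mkY prY rsY hY) (ops Y).

Let bind_out (s : reg K) : O1 * O2 :=
  (out (e := X) (s.2.1.2, s.2.1.1), out (e := Y) (s.1, s.2.2)).

Let bind_init : reg K := ((init X).1, ((init X).2, (init Y).1, (init Y).2)).

Lemma bind_wf : wf_ops bind_ops.
Proof.
apply: wf_cat; last split.
- by apply: wf_lift (wf_expt X) => [[? [[? ?] ?]]|[[? ?] ?] [[? ?] ?]|? [? ?]].
- move=> _; apply: isometry_reindex.
  by apply: (@can_inj _ _ _ swp) => -[? [[? ?] ?]].
- by apply: wf_lift (wf_expt Y) => [[? [[? ?] ?]]|[[? ?] ?] [? [? ?]]|? [? ?]].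
Qed.

Definition bind : expt I (O1 * O2)%type :=
  @Expt I (O1 * O2)%type K bind_init bind_ops bind_out bind_wf.

Lemma nq_bind : nq bind = (nq X + nq Y)%N.
Proof. by rewrite /nq /= count_cat /= !nq_lift. Qed.

(** Principle of deferred measurement: the record of the first stage is only read afterwards, so
    amplitudes multiply and the probabilities are those of a measurement made between the stages. *)
Lemma amp_bind i U s : unitary_op U ->
  amp bind i U s = amp X i U (s.2.1.2, s.2.1.1) *
    amp Y (i, out (e := X) (s.2.1.2, s.2.1.1)) U (s.1, s.2.2).
Proof.
move=> Uu; rewrite /amp /= /run foldl_cat /= -!/(run _ _ _ _).
rewrite (run_lift (I := I) (J := I * O1) (mk := mkY)); first last.
- by move=> [[? ?] ?] [? [? ?]].
- by move=> [[? ?] ?] [? [? ?]].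
- by move=> ? [].
- by move=> [[? ?] ?] [? [? ?]].
- by move=> [? [[? ?] ?]].
rewrite {1}/hY /rsY /prY /=.
set a := amp X i U (s.2.1.2, s.2.1.1).
(* For a fixed record, the second program receives [a] times its own initial state; linearity
   extracts the scalar. *)
rewrite -[RHS]/((fun t => _ * amp Y _ U t) _) -isometryZ; last first.
  by apply: isometry_run => //; exact: wf_expt.
congr (run _ _ _ _ _); apply/funext => t.
rewrite (run_lift (I := I) (J := I) (mk := mkX)); first last.
- by move=> [[? ?] ?] [[? ?] ?].
- by move=> [[? ?] ?] [[? ?] ?].
- by move=> ? [].
- by move=> [[? ?] ?] [[? ?] ?].
- by move=> [? [[? ?] ?]].
rewrite /swp /mkY /prX /rsX /=.
have [->|tY] := eqVneq t (init Y).
  rewrite /basis eqxx mulr1 /a /amp; congr (run _ _ _ _ _).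
  apply/funext => r; rewrite /basis /mkX /bind_init /=.
  by case: r (init X) (init Y) => [? ?] [? ?] [? ?] /=; rewrite !xpair_eqE !eqxx !andbT.
rewrite /basis (negbTE tY) mulr0.
have -> : (fun r => (mkX r (t.1, t.2) == bind_init)%:R) = fun r => 0 * basis R (init X) r.
  apply/funext => r; rewrite mul0r; case: eqP => // e; case/eqP: tY.
  by have := congr1 (fun s : reg K => (s.2.1.2, s.2.2)) e; rewrite /= -!surjective_pairing.
by rewrite isometryZ ?mul0r //; apply: isometry_run => //; exact: wf_expt.
Qed.

Lemma Ex_bind i U f : unitary_op U ->
  Ex bind i U f = Ex X i U (fun o1 => Ex Y (i, o1) U (fun o2 => f (o1, o2))).
Proof.
move=> Uu; rewrite /Ex.
under [RHS]eq_bigr => s _ do rewrite mulr_sumr.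
rewrite pair_bigA /=.
rewrite (reindex (fun p : reg (anc X) * reg (anc Y) =>
    (p.2.1, (p.1.2, p.1.1, p.2.2)) : reg K)) /=; last first.
  exists (fun s : reg K => ((s.2.1.2, s.2.1.1), (s.1, s.2.2))).
    by move=> [[? ?] [? ?]].
  by move=> [? [[? ?] ?]].
apply: eq_bigr => -[[m k1] [b k2]] _ /=.
by rewrite amp_bind //= sqnM mulrA.
Qed.

End Bind.
End Programs.
Arguments amp {R d I O} X i U _.

Section Indicators.
Variable R : realType.

Lemma ind_le (b b1 : bool) : (b -> b1) -> ind b <= ind b1 :> R.
Proof. by case: b => [->|_]. Qed.

Lemma ind_le_or (b b1 b2 : bool) : (b -> b1 || b2) -> ind b <= ind b1 + ind b2 :> R.
Proof.
by case: b => [/(_ isT)|_]; case: b1; case: b2; rewrite ?addr0 ?add0r ?lerDl ?addr_ge0.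
Qed.

End Indicators.

(** * Translation of programs into query algorithms *)

Section Compile.
Variables (R : realType) (d : nat).
Local Notation C := R[i].

Fixpoint alternate (K : finType) (V : nat -> (reg d K -> C) -> (reg d K -> C))
    (dir : nat -> bool) (U : qop R 'I_d) n v : reg d K -> C :=
  if n is n'.+1 then V n (query U (dir n) (alternate V dir U n' v)) else V 0%N v.

(** Adjacent gates merge into one, and identities are inserted between adjacent queries. *)
Lemma run_alternate (K : finType) (l : seq (op R d unit K)) : wf_ops l ->
  exists V dir, (forall t : nat, isometry (V t)) /\
    forall U v, run tt U l v = alternate V dir U (count (@is_query R d unit K) l) v.
Proof.
elim: l => [|o l IH] /= wl.
  by exists (fun=> id), (fun=> true); split=> // t; exact: isometry_id.
have [V [dir [iV E]]] := IH wl.2; case: o wl => [A|b] /= [wA _].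
  exists (fun t => if t is 0%N then V 0%N \o A tt else V t), dir; split=> [[|t]|U v].
  - exact: isometry_comp.
  - exact: iV.
  rewrite E add0n; elim: (count _ l) => //= n ->; by [].
(* A leading query shifts the schedule by one; as in [run_state], directions are numbered from 1. *)
exists (fun t => if t is t'.+1 then V t' else id),
  (fun t => if t is t'.+2 then dir t'.+1 else b); split=> [[|t]|U v].
- exact: isometry_id.
- exact: iV.
rewrite E add0n; elim: (count _ l) => //= n ->; by [].
Qed.

Definition decode (K : finType) (s : reg d 'I_#|K|) : reg d K := (s.1, enum_val s.2).
Definition encode (K : finType) (s : reg d K) : reg d 'I_#|K| := (s.1, enum_rank s.2).

Lemma encodeK (K : finType) : cancel (@encode K) (@decode K).
Proof. by move=> [b a]; rewrite /encode /decode /= enum_rankK. Qed.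

Lemma decodeK (K : finType) : cancel (@decode K) (@encode K).
Proof. by move=> [b a]; rewrite /encode /decode /= enum_valK. Qed.

Lemma sum_decode (V : nmodType) (K : finType) (F : reg d K -> V) :
  \sum_s F s = \sum_s F (decode s).
Proof.
by apply: (reindex (@decode K)); exists (@encode K) => s _; rewrite (decodeK, encodeK).
Qed.

Lemma ctrlU_query (K : finType) b U (v : reg d K -> C) l :
  \sum_m ctrlU b U l m * v (decode m) = query U b v (decode l).
Proof.
case: l => [[c x] a]; rewrite sum_reg (bigD1 c) //= [X in _ + X]big1 ?addr0; last first.
  move=> c' c'c; apply: big1 => a' _; apply: big1 => x' _.
  by rewrite [c == c']eq_sym (negbTE c'c) andbF mul0r.
rewrite (bigD1 a) //= [X in _ + X]big1 ?addr0; last first.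
  move=> a' a'a; apply: big1 => x' _.
  by rewrite [a == a']eq_sym (negbTE a'a) mul0r.
rewrite /query !eqxx /=; case: (nat_of_ord c == 1)%N => //.
rewrite (bigD1 x) //= eqxx mul1r big1 ?addr0 // => x' x'x.
by rewrite eq_sym (negbTE x'x) mul0r.
Qed.

Lemma compile (O : finType) (X : expt R d unit O) (g : O -> 'I_d -> C) :
  exists k (A : query_algo R d k), [/\ qnq A = nq X,
    forall t : nat, unitary_op (qV A t) &
    forall U q eps alpha, success_prob A U q eps alpha =
      Ex X tt U (fun o => ind (lq_dist q alpha (g o) <= eps))].
Proof.
have [V [dir [iV E]]] := run_alternate (wf_expt X).
exists #|anc X|, (@QueryAlgo R d #|anc X| (nq X) (encode (init X)) dir
  (fun t s s' => V t (basis R (decode s')) (decode s)) (fun s => g (out (decode s)))).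
split=> // [t|U q eps alpha].
  move=> i j; have := isometry_unitary (iV t) (decode i) (decode j).
  rewrite sum_decode (inj_eq (can_inj (@decodeK _))) => <-.
  by apply: eq_bigr => s _; rewrite /cconj.
rewrite /success_prob /Ex sum_decode big_mkcond /=.
have RS n s : run_state (QueryAlgo (nq X) (encode (init X)) dir
      (fun t s s' => V t (basis R (decode s')) (decode s)) (fun s => g (out (decode s)))) U n s =
    alternate V dir U n (basis R (init X)) (decode s).
  elim: n s => [|n IH] s /=; first by rewrite encodeK.
  rewrite [RHS]isometry_expand // [RHS]sum_decode; apply: eq_bigr => l _; congr (_ * _).
  rewrite -ctrlU_query; apply: eq_bigr => m _; by rewrite IH.
apply: eq_bigr => s _; rewrite /final_state /= RS /amp E -/(nq X) cabs_sqr.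
by case: ifP => _; rewrite ?mulr1 ?mulr0.
Qed.

End Compile.

(** * Independent repetitions and concentration *)

Section Repetition.
Variables (R : realType) (d : nat) (hd : (0 < d)%N).
Local Notation C := R[i].
Local Notation x0 := (Ordinal hd).

Definition triv I (O : finType) (o : O) : expt R d I O :=
  @Expt R d I O unit (ord0, x0, tt) [::] (fun=> o) Logic.I.

Lemma Ex_triv I (O : finType) (o : O) (i : I) U f : Ex (triv I o) i U f = f o.
Proof. by rewrite /Ex /= -mulr_suml -/(nrm2 _) nrm2_basis mul1r. Qed.

Section Rep.
Variables (I : Type) (O : finType) (X : expt R d I O).

Fixpoint rep N : expt R d I (N.-tuple O) :=
  if N is N'.+1 then
    emap (fun p => cons_tuple p.1 p.2) (bind X (reparam fst (rep N')))
  else triv I [tuple].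

Lemma nq_rep N : nq (rep N) = (N * nq X)%N.
Proof. by elim: N => //= N IH; rewrite nq_emap nq_bind nq_reparam IH mulSn. Qed.

Lemma Ex_rep_prod N i U (g : O -> R) : unitary_op U ->
  Ex (rep N) i U (fun os => \prod_(o <- os) g o) = Ex X i U g ^+ N.
Proof.
move=> Uu; elim: N => [|N IH] /=; first by rewrite Ex_triv big_nil.
rewrite Ex_emap Ex_bind // exprS -IH mulrC -ExZ; apply: eq_Ex => o /=.
rewrite Ex_reparam mulrC -ExZ; apply: eq_Ex => os /=.
by rewrite big_cons.
Qed.

End Rep.

(** [e^x (1 - x) <= 1], whereas [(1 + x + 2 x^2)(1 - x) = 1 + x^2 (1 - 2 x) >= 1]. *)
Lemma expR_le_quad (x : R) : x <= 1/2 -> expR x <= 1 + x + 2 * x ^+ 2.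
Proof.
move=> x2; have x1 : 0 < 1 - x by lra.
have := expR_ge1Dx (- x); rewrite expRN => h.
have e0 := expR_gt0 x.
have : expR x * (1 - x) <= 1 by rewrite -ler_pdivlMl // mulr1.
move=> h1; rewrite -(ler_pM2r x1); apply: (le_trans h1).
have : 0 <= x ^+ 2 * (1 - 2 * x) by rewrite mulr_ge0 ?sqr_ge0 //; lra.
nra.
Qed.

Variables (I : Type) (O : finType) (X : expt R d I O) (i : I) (U : qop R 'I_d).
Hypothesis Uu : unitary_op U.

(** Exponential Markov inequality in Bernstein's form: [expR_le_quad] bounds the exponential moment
    through the second moment [v], and [lam] is left free for the applications to optimize. *)
Lemma chernoff (f : O -> R) (v lam t : R) N :
  (forall o, `|f o| <= 1) -> Ex X i U (fun o => f o ^+ 2) <= v ->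
  0 <= lam <= 1/2 ->
  Ex (rep X N) i U (fun os => ind (N%:R * (Ex X i U f + t) <= \sum_(o <- os) f o))
    <= expR (- (N%:R * (lam * t - 2 * lam ^+ 2 * v))).
Proof.
move=> f1 fv /andP[l0 l2]; set mu := Ex X i U f.
have step1 : Ex (rep X N) i U
      (fun os => ind (N%:R * (mu + t) <= \sum_(o <- os) f o)) <=
    expR (- (lam * (N%:R * (mu + t)))) * Ex X i U (fun o => expR (lam * f o)) ^+ N.
  rewrite -Ex_rep_prod // -ExZ; apply: Ex_le => os.
  rewrite -expR_sum -expRD -mulr_sumr [- _ + _]addrC -mulrBr.
  case: (leP (N%:R * (mu + t))) => h /=; last exact: expR_ge0.
  by rewrite -{1}expR0 ler_expR mulr_ge0 // subr_ge0.
apply: (le_trans step1).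
have step2 : Ex X i U (fun o => expR (lam * f o)) <= expR (lam * mu + 2 * lam ^+ 2 * v).
  have h : Ex X i U (fun o => expR (lam * f o)) <=
      Ex X i U (fun o => 1 + (lam * f o + 2 * lam ^+ 2 * f o ^+ 2)).
    apply: Ex_le => o; have := f1 o; rewrite ler_norml => /andP[fl fu].
    have -> : 1 + (lam * f o + 2 * lam ^+ 2 * f o ^+ 2) =
      1 + (lam * f o) + 2 * (lam * f o) ^+ 2 by ring.
    apply: expR_le_quad; nra.
  apply: (le_trans h); rewrite !ExD !ExZ Ex_cst // -/mu.
  apply: le_trans (expR_ge1Dx _); rewrite lerD2l lerD2l.
  by rewrite ler_wpM2l // mulr_ge0 // sqr_ge0.
have step3 := lerXn2r N (_ : 0 <= _) (_ : 0 <= _) step2.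
apply: (le_trans (ler_wpM2l (expR_ge0 _) (step3 _ _))).
- rewrite -(Ex_cst X i 0 Uu); apply: Ex_le => o; exact: expR_ge0.
- exact: expR_ge0.
rewrite -expRM_natl -expRD ler_expR.
by rewrite le_eqVlt; apply/orP; left; apply/eqP; ring.
Qed.

Lemma concentration (f : O -> R) (a s : R) N :
  (forall o, `|f o| <= 1) -> 0 < a -> 0 < s -> s <= 5 * a ->
  Ex X i U (fun o => f o ^+ 2) <= 5 / 2 * a ^+ 2 ->
  Ex (rep X N) i U
     (fun os => ind (~~ (`|\sum_(o <- os) f o - N%:R * Ex X i U f| <= N%:R * (a * s))))
    <= 2 * expR (- (N%:R * (s ^+ 2 / 20))).
Proof.
move=> f1 a0 s0 sa fv.
(* The hypothesis [s <= 5 a] says precisely that [lam <= 1/2]. The exponent is [s^2/10 - s^2/20], in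
   which [a] has cancelled. *)
pose lam := s / (10 * a).
have lam_ok : 0 <= lam <= 1/2.
  rewrite divr_ge0 ?(ltW s0) ?mulr_ge0 ?(ltW a0) //=.
  rewrite ler_pdivrMr ?mulr_gt0 //; lra.
have cst : lam * (a * s) - 2 * lam ^+ 2 * (5 / 2 * a ^+ 2) = s ^+ 2 / 20.
  by rewrite /lam; field; rewrite gt_eqF.
have up := chernoff (a * s) N f1 fv lam_ok.
have f1' o : `|- f o| <= 1 by rewrite normrN.
have fv' : Ex X i U (fun o => (- f o) ^+ 2) <= 5 / 2 * a ^+ 2.
  by apply: le_trans fv; apply: Ex_le => o; rewrite sqrrN.
have dn := chernoff (a * s) N f1' fv' lam_ok.
rewrite cst in up dn.
have muN : Ex X i U (fun o => - f o) = - Ex X i U f.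
  by rewrite -mulN1r -ExZ; apply: eq_Ex => o; rewrite mulN1r.
rewrite [2 * _]mulr_natl mulr2n; apply: le_trans (lerD up dn).
rewrite -ExD; apply: Ex_le => os; rewrite muN.
set S := \sum_(o <- os) f o.
have -> : \sum_(o <- os) - f o = - S by rewrite -sumrN.
apply: ind_le_or; rewrite ler_norml negb_and -!ltNge => /orP[h|h]; apply/orP; [right|left]; lra.
Qed.

Lemma lower_tail (b : pred O) (p : R) N :
  p <= Ex X i U (fun o => (b o)%:R) ->
  Ex (rep X N) i U
     (fun os => ind (~~ (N%:R * Ex X i U (fun o => ind (b o)) / 2 <= (count b os)%:R)))
    <= expR (- (N%:R * (p / 32))).
Proof.
move=> pb; set m := Ex X i U _ in pb *.
have f1 o : `|- (b o)%:R| <= 1 :> R by rewrite normrN; case: (b o); rewrite ?normr1 ?normr0.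
have fv : Ex X i U (fun o => (- (b o)%:R) ^+ 2) <= m.
  by apply: Ex_le => o; case: (b o); rewrite sqrrN ?expr1n ?expr0n.
(* An indicator has second moment equal to its mean [m]; with [lam = 1/8] the exponent is
   [m/16 - m/32]. *)
have := chernoff (m / 2) N f1 fv (_ : 0 <= 1/8 <= 1/2).
have -> : Ex X i U (fun o => - (b o)%:R) = - m.
  by rewrite -mulN1r -ExZ; apply: eq_Ex => o; rewrite mulN1r.
have -> : 1 / 8 * (m / 2) - 2 * (1 / 8) ^+ 2 * m = m / 32 by field.
move=> /(_ _) h; apply: le_trans (le_trans (h _) _); last first.
- by rewrite ler_expR lerN2 ler_wpM2l ?ler_pM2r.
- by apply/andP; split; lra.
apply: Ex_le => os.
have -> : \sum_(o <- os) - (b o)%:R = - (count b os)%:R :> R.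
  by rewrite sumrN -sum1_count natr_sum [in RHS]big_mkcond /=; congr (- _);
    apply: eq_bigr => o _; case: (b o).
by apply: ind_le; rewrite -ltNge => hc; lra.
Qed.

End Repetition.

(** * Amplitude amplification and interference *)

Section Rotation.
Variables (R : realType) (T : finType) (phi psi : T -> R[i]).
Hypotheses (phi1 : nrm2 phi = 1) (psi1 : nrm2 psi = 1).
Let z := ip phi psi.
Let om : T -> R[i] := fun t => psi t - z * phi t.
Let S : R := nrm2 om.

Lemma om_add : om = fun t => - z * phi t + psi t.
Proof. by apply/funext => t; rewrite /om addrC mulNr. Qed.

Lemma ip_phi_om : ip phi om = 0.
Proof. by rewrite om_add ipDr ip_nrm2 phi1 -/z mulr1 addNr. Qed.

Lemma sqn_overlap : sqn z = 1 - S.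
Proof.
have : nrm2 psi = sqn z + S.
  have -> : psi = fun t => z * phi t + om t by apply/funext => t; rewrite /om addrC subrK.
  by rewrite nrm2D ip_phi_om phi1 mulr0 mulr1 mulr0 addr0.
by rewrite psi1 => ->; rewrite addrK.
Qed.

(** Pythagoras: one known distance, from [psi] to some multiple [c phi], bounds both the orthogonal
    part [S] and the error of [c] as a value for the overlap. *)
Lemma nrm2_sub_proj (c : R[i]) :
  nrm2 (fun t => psi t - c * phi t) = S + sqn (z - c).
Proof.
have -> : (fun t => psi t - c * phi t) = fun t => (z - c) * phi t + om t.
  by apply/funext => t; rewrite /om; ring.
by rewrite nrm2D ip_phi_om phi1 mulr0 /= mulr0 mulr1 addr0 addrC.
Qed.

Lemma ip_psi_om : ip psi om = ((S)%:C)%C.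
Proof.
rewrite -[RHS]ip_nrm2 [X in ip X _ = _](_ : psi = fun t => z * phi t + om t).
  by rewrite ipDl ip_phi_om mulr0 add0r.
by apply/funext => t; rewrite /om addrC subrK.
Qed.

(* One step of amplitude amplification in the plane of [phi] and [psi]; the
   coefficients are those of a rotation by twice the angle whose squared sine is [S]. *)
Lemma rotation_step (a b : R) :
  refl psi (refl phi (fun t => ((a)%:C)%C * phi t + ((b)%:C)%C * conjc z * om t)) =
  fun t => (((1 - 2 * S) * a - 2 * S * (1 - S) * b)%:C)%C * phi t +
    ((2 * a + (1 - 2 * S) * b)%:C)%C * conjc z * om t.
Proof.
have r1 : refl phi (fun t => ((a)%:C)%C * phi t + ((b)%:C)%C * conjc z * om t) =
    fun t => - ((a)%:C)%C * phi t + ((b)%:C)%C * conjc z * om t.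
  apply/funext => t; rewrite /refl phi1 divr1 ipDr ip_nrm2 phi1 mulr1.
  have -> : (fun t => ((b)%:C)%C * conjc z * om t) =
    fun t => ((b)%:C)%C * conjc z * om t + (fun=> 0) t.
    by apply/funext => s; rewrite addr0.
  rewrite ipDr ip_phi_om mulr0 add0r.
  have -> : ip phi (fun=> 0) = 0 by rewrite /ip big1 // => s _; rewrite mulr0.
  have -> : ((2 : R)%:C)%C = 2 :> R[i] by rewrite rmorph_nat.
  by rewrite addr0; ring.
rewrite r1; apply/funext => t; rewrite /refl psi1 divr1 ipDr.
have -> : (fun t => ((b)%:C)%C * conjc z * om t) =
    fun t => ((b)%:C)%C * conjc z * om t + (fun=> 0) t.
  by apply/funext => s; rewrite addr0.
rewrite ipDr ip_psi_om -(ipC phi psi) -/z.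
have -> : ip psi (fun=> 0) = 0 by rewrite /ip big1 // => s _; rewrite mulr0.
have psiE : psi t = z * phi t + om t by rewrite /om addrC subrK.
rewrite psiE addr0.
have zz : conjc z * z = 1 - ((S)%:C)%C.
  by rewrite conjcMz sqn_overlap rmorphB rmorph1.
rewrite !(rmorphD, rmorphB, rmorphM, rmorphN) /= !rmorph1.
have -> : 1 - (S%:C)%C = conjc z * z by [].
have -> : (S%:C)%C = 1 - conjc z * z by rewrite zz opprB addrC subrK.
ring.
Qed.

(** If [S] is the squared sine of [th], then [a = cos (2 p th)] and
    [b = sin (2 p th) / (sin th cos th)], which is close to [2 p] while [p th] is small. The bounds
    come from the recursion alone, so that [S = 0] is no exception. *)
Lemma rotation_power p : exists a b : R,
  iter p (refl psi \o refl phi) phi =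
    (fun t => ((a)%:C)%C * phi t + ((b)%:C)%C * conjc z * om t) /\
  `|b| <= 2 * p%:R /\ `|b - 2 * p%:R| <= 4 / 3 * S * p%:R ^+ 3.
Proof.
have S0 : 0 <= S := nrm2_ge0 _.
have S1 : S <= 1 by have := sqn_ge0 z; rewrite sqn_overlap subr_ge0.
have S2 : 0 <= 1 - S by rewrite subr_ge0.
(* The induction also carries the normalization, which yields [|a| <= 1], and a quadratic bound on
   [1 - a], whose contributions sum to the cubic bound on [b]. *)
suff [a [b [-> [ab [bp [ap bb]]]]]] : exists a b : R,
  iter p (refl psi \o refl phi) phi =
    (fun t => ((a)%:C)%C * phi t + ((b)%:C)%C * conjc z * om t) /\
  (a ^+ 2 + S * (1 - S) * b ^+ 2 = 1 /\
  (`|b| <= 2 * p%:R /\ (`|1 - a| <= 2 * S * p%:R ^+ 2 /\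
   `|b - 2 * p%:R| <= 4 / 3 * S * p%:R ^+ 3))).
  by exists a, b.
elim: p => [|p [a [b [E [ab [bp [ap bb]]]]]]].
  exists 1, 0; split; first by apply/funext => t /=; rewrite rmorph0 !mul0r addr0 mul1r.
  by rewrite expr1n !expr0n /= !mulr0 !subrr !normr0 addr0; do !split.
exists ((1 - 2 * S) * a - 2 * S * (1 - S) * b), (2 * a + (1 - 2 * S) * b).
split; first by rewrite iterS E /= rotation_step.
split; first by rewrite -[RHS]ab; ring.
have p0 : 0 <= p%:R :> R by rewrite ler0n.
have a1 : `|a| <= 1.
  have := normr_ge0 a; have : 0 <= S * (1 - S) * b ^+ 2.
    by apply: mulr_ge0; [exact: mulr_ge0|exact: sqr_ge0].
  have : `|a| ^+ 2 = a ^+ 2 by rewrite real_normK ?num_real.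
  nra.
move: a1 bp ap bb; rewrite !ler_norml -natr1; set P : R := p%:R in p0 *.
move=> /andP[a1 a2] /andP[b1 b2] /andP[c1 c2] /andP[e1 e2].
have Sb1 : S * b <= 2 * P * S by rewrite mulrC ler_wpM2r.
have Sb2 : - (2 * P * S) <= S * b by rewrite -mulNr mulrC ler_wpM2l // -mulNr mulrN.
have Sa1 : S * a <= S by rewrite ler_piMr.
have Sa2 : - S <= S * a by rewrite -[- S]mulr1 mulNr -mulrN ler_wpM2l.
have SSb1 : S * (S * b) <= S * (2 * P * S) by rewrite ler_wpM2l.
have SSb2 : S * - (2 * P * S) <= S * (S * b) by rewrite ler_wpM2l.
have PS : 0 <= P * S by rewrite mulr_ge0.
have PS1 : S * (P * S) <= P * S by rewrite ler_piMl.
have P2S : 0 <= P ^+ 2 * S by rewrite mulr_ge0 ?sqr_ge0.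
have Q1 : (1 - S) * (S * b) <= 2 * P * S.
  by have := ler_wpM2l S2 Sb1; nra.
have Q2 : - (2 * P * S) <= (1 - S) * (S * b).
  by have := ler_wpM2l S2 Sb2; nra.
have Q3 : - (2 * P) <= (1 - 2 * S) * b <= 2 * P.
  by apply/andP; split; nra.
case/andP: Q3 => Q3 Q4.
split; first by apply/andP; split; lra.
split; first by apply/andP; split; nra.
by apply/andP; split; nra.
Qed.

End Rotation.

(** * Interference with a reference state *)

Section Interference.
Variables (R : realType) (d : nat).
Local Notation C := R[i].
Local Notation base := ('I_2 * 'I_d)%type.
Local Notation sector := (option bool).

Definition rh : C := ((Num.sqrt 2)^-1%:C)%C.

Lemma rh_sqr : rh * rh = 2^-1.
Proof.
rewrite /rh -rmorphM /= -invfM -expr2 sqr_sqrtr // fmorphV /=.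
by rewrite (rmorph_nat (real_complex R)).
Qed.

Lemma conj_rh : conjc rh = rh.
Proof. exact: conjc_real. Qed.

Lemma sqn_rh : sqn rh = 2^-1.
Proof. by rewrite /rh sqnR exprVn sqr_sqrtr. Qed.

Lemma sum_sector (V : nmodType) (T : finType) (F : T * sector -> V) :
  \sum_s F s = \sum_y (F (y, None) + (F (y, Some false) + F (y, Some true))).
Proof.
rewrite (eq_bigr (fun s => F (s.1, s.2))) => [|[]//].
rewrite -(pair_bigA _ (fun y k => F (y, k))) /=; apply: eq_bigr => y _.
rewrite (bigD1 None) //=; congr (_ + _).
rewrite (bigD1 (Some false)) //=; congr (_ + _).
by rewrite (bigD1 (Some true)) //= big1 ?addr0 // => -[[]|].
Qed.

(* Sectors of the ancilla: [Some false] carries the reference state, [Some true]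
   the state under study, [None] what has been filtered out. *)
Definition hadamard (v : reg d sector -> C) : reg d sector -> C := fun s =>
  match s.2 with
  | None => v s
  | Some false => rh * (v (s.1, Some false) + v (s.1, Some true))
  | Some true => rh * (v (s.1, Some false) - v (s.1, Some true))
  end.

Lemma isometry_hadamard : isometry hadamard.
Proof.
split=> [c u v|u v].
  by apply/funext => -[y [[]|]]; rewrite /hadamard /=; ring.
rewrite /ip !sum_sector; apply: eq_bigr => y _; rewrite /hadamard /=.
congr (_ + _); rewrite !conjcM conj_rh -!mulrA.
rewrite !(mulrCA _ rh) !mulrA rh_sqr conjcB conjcD.
by field.
Qed.

Definition contrast (y : base) (o : reg d sector) : R :=
  if o.1 == y then (if o.2 is Some b then (if b then -1 else 1) else 0) else 0.

Lemma contrast_le1 y o : `|contrast y o| <= 1.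
Proof.
rewrite /contrast; case: ifP => _; rewrite ?normr0 //.
by case: (o.2) => [[]|]; rewrite ?normrN ?normr1 ?normr0.
Qed.

Record interferometer (I : Type) := Interferometer {
  prep_init : reg d sector;
  prep_ops : seq (op R d I sector);
  prep_wf : wf_ops prep_ops
}.

Section Interferometer.
Variables (I : Type) (P : interferometer I).

Lemma interf_wf : wf_ops (rcons (prep_ops P) (Gate (fun=> hadamard))).
Proof.
rewrite -cats1; apply: wf_cat; first exact: prep_wf.
by split=> // i; exact: isometry_hadamard.
Qed.

Definition interf : expt R d I (reg d sector) :=
  @Expt R d I (reg d sector) sector (prep_init P) _ id interf_wf.

Lemma nq_interf : nq interf = count (@is_query R d I sector) (prep_ops P).
Proof. by rewrite /nq /= -cats1 count_cat /= !addn0. Qed.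

Variables (i : I) (U : qop R 'I_d) (y : base) (A B : C).
Let g := run i U (prep_ops P) (basis R (prep_init P)).
Hypothesis gA : g (y, Some false) = rh * A.
Hypothesis gB : g (y, Some true) = rh * B.

Lemma amp_interf (b : bool) :
  amp interf i U (y, Some b) = 2^-1 * (if b then A - B else A + B).
Proof.
rewrite /amp /= /run -cats1 foldl_cat /= -!/(run _ _ _ _) -/g.
by rewrite /hadamard /= gA gB -rh_sqr; case: b; ring.
Qed.

Lemma Ex_interf (f : R -> R) : f 0 = 0 ->
  Ex interf i U (f \o contrast y) =
  f 1 * (sqn (A + B) / 4) + f (-1) * (sqn (A - B) / 4).
Proof.
move=> f0; rewrite /Ex /= sum_sector (bigD1 y) //= [X in _ + X]big1 ?addr0.
  rewrite /contrast eqxx /= f0 mulr0 add0r !amp_interf !sqnM.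
  have -> : sqn (2^-1 : C) = 4^-1.
    have -> : (2^-1 : C) = rh * rh by rewrite rh_sqr.
    by rewrite sqnM sqn_rh -invfM -natrM.
  ring.
by move=> y' y'y; rewrite /contrast /= (negbTE y'y) f0 !mulr0 !addr0.
Qed.

Lemma Ex_contrast : Ex interf i U (contrast y) = Re (conjc A * B).
Proof.
rewrite -sqn_interfere_diff.
have -> : Ex interf i U (contrast y) = Ex interf i U (id \o contrast y) by [].
by rewrite Ex_interf // mul1r mulN1r.
Qed.

Lemma Ex_contrast2 :
  Ex interf i U (fun o => contrast y o ^+ 2) = (sqn A + sqn B) / 2.
Proof.
rewrite -sqn_interfere_sum.
have -> : Ex interf i U (fun o => contrast y o ^+ 2) =
  Ex interf i U ((fun r => r ^+ 2) \o contrast y) by [].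
by rewrite Ex_interf ?expr0n // sqrrN expr1n !mul1r.
Qed.

End Interferometer.

(** Phase given to a real reference: [1] makes the interference reveal the real part of an
    amplitude, [i] the imaginary part. *)
Definition quad (b : bool) : C := if b then 'i%C else 1.
Definition part (b : bool) (z : C) : R := if b then Im z else Re z.

Lemma Re_quad b (a : R) z : Re (conjc (quad b * (a%:C)%C) * z) = a * part b z.
Proof. by case: b z => -[p q]; rewrite /quad /=; ring. Qed.

Lemma sqn_quad b : sqn (quad b) = 1.
Proof. by case: b; rewrite /quad /sqn /=; ring. Qed.

Section StatePreparation.
Variables (b : bool) (a : base -> R) (v : base -> C).
Hypotheses (a1 : \sum_y a y ^+ 2 = 1) (v1 : nrm2 v = 1).

Definition superposed (a : base -> R) (v : base -> C) : reg d sector -> C := fun s =>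
  match s.2 with
  | None => 0
  | Some false => rh * (quad b * ((a s.1)%:C)%C)
  | Some true => rh * v s.1
  end.

Lemma nrm2_superposed : nrm2 (superposed a v) = 1.
Proof.
rewrite /nrm2 sum_sector /superposed /=.
under eq_bigr => y _ do rewrite sqn0 add0r !sqnM sqn_rh sqn_quad sqnR mul1r -mulrDr.
by rewrite -mulr_sumr big_split /= a1 -/(nrm2 v) v1; field.
Qed.

Lemma prepare_superposed y : Im (v y) = 0 ->
  refl (fun s => basis R (y, Some true) s - superposed a v s) (basis R (y, Some true)) =
  superposed a v.
Proof.
move=> vy; apply: refl_basis; first exact: nrm2_superposed.
by rewrite /superposed /=; case: (v y) vy => p q /= ->; rewrite mul0r mulr0 addr0.
Qed.

End StatePreparation.

Section DirectTomography.
Variables (x0 : 'I_d).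

Definition lift_ref (a : 'I_d -> R) (y : base) : R := if y.1 == ord0 then a y.2 else 0.

(** The query has to act on the studied state, kept at control 1, and to spare the reference, kept
    at control 0. Flipping the control of the studied sector afterwards makes the two meet at the
    same labels. *)
Definition flip (s : reg d sector) : reg d sector :=
  if s.2 == Some true then ((rev_ord s.1.1, s.1.2), s.2) else s.

Lemma flipK : involutive flip.
Proof. by move=> [[c x] [[]|]]; rewrite /flip //= rev_ordK. Qed.

Definition direct_ops : seq (op R d (bool * ('I_d -> R)) sector) :=
  [:: Gate (fun i => refl (fun s => basis R ((ord_max, x0), Some true) s -
         superposed i.1 (lift_ref i.2) (basis R (ord_max, x0)) s));
      Query _ _ _ _ true; Gate (fun _ v s => v (flip s))].

Lemma direct_wf : wf_ops direct_ops.
Proof.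
split; first by move=> i; exact: isometry_refl.
by do 2!split=> //; move=> _; apply/isometry_reindex/inv_inj/flipK.
Qed.

Definition direct := interf (Interferometer ((ord_max, x0), Some true) direct_wf).

Lemma nq_direct : nq direct = 1%N.
Proof. by rewrite nq_interf. Qed.

Variables (b : bool) (a : 'I_d -> R) (U : qop R 'I_d).
Hypothesis a1 : \sum_x a x ^+ 2 = 1.

Lemma lift_ref1 : \sum_y lift_ref a y ^+ 2 = 1.
Proof.
rewrite (eq_bigr (fun y => lift_ref a (y.1, y.2) ^+ 2)) => [|[]//].
rewrite -(pair_bigA _ (fun c x => lift_ref a (c, x) ^+ 2)) /=.
rewrite big_ord_recl big_ord_recl big_ord0 addr0 /lift_ref /= a1.
by rewrite big1 ?addr0 // => x _; rewrite expr0n.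
Qed.

Let g := run (b, a) U direct_ops (basis R ((ord_max, x0), Some true)).

Lemma direct_state :
  g = fun s => query U true (superposed b (lift_ref a) (basis R (ord_max, x0))) (flip s).
Proof.
rewrite /g /run /= prepare_superposed //; first exact: lift_ref1.
  exact: nrm2_basis.
by rewrite /basis eqxx.
Qed.

Lemma direct_ref x : g ((ord0, x), Some false) = rh * (quad b * ((a x)%:C)%C).
Proof. by rewrite direct_state. Qed.

Lemma direct_sys x : g ((ord0, x), Some true) = rh * U x x0.
Proof.
have fl : flip ((ord0, x), Some true) = ((ord_max, x), Some true).
  by rewrite /flip /=; congr (_, _, _); exact: val_inj.
rewrite direct_state fl /query /= (bigD1 x0) //= big1 ?addr0.
  by rewrite /superposed /basis /= eqxx mulr1 mulrC.
by move=> x' x'0; rewrite /superposed /basis /= xpair_eqE (negbTE x'0) andbF !mulr0.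
Qed.

Let P := Interferometer ((ord_max, x0), Some true) direct_wf.

Lemma Ex_direct x : Ex direct (b, a) U (contrast (ord0, x)) = a x * part b (U x x0).
Proof. by rewrite (Ex_contrast (P := P) (direct_ref x) (direct_sys x)) Re_quad. Qed.

Lemma Ex_direct2 x : Ex direct (b, a) U (fun o => contrast (ord0, x) o ^+ 2) =
  (a x ^+ 2 + sqn (U x x0)) / 2.
Proof.
by rewrite (Ex_contrast2 (P := P) (direct_ref x) (direct_sys x)) sqnM sqn_quad mul1r sqnR.
Qed.

End DirectTomography.

End Interference.

(** * Amplification of the difference between the state and a guess *)

Section Amplification.
Variables (R : realType) (d : nat) (x0 : 'I_d).
Local Notation C := R[i].
Local Notation base := ('I_2 * 'I_d)%type.
Local Notation sector := (option bool).

Lemma reflZ (T : finType) (w v : T -> C) c :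
  refl w (fun t => c * v t) = fun t => c * refl w v t.
Proof. exact: isometryZ (isometry_refl w). Qed.

Definition embed (w : base -> C) : reg d sector -> C :=
  fun s => if s.2 is Some true then w s.1 else 0.

Lemma refl_embed w (v : reg d sector -> C) :
  refl (embed w) v = fun s =>
    if s.2 is Some true then refl w (fun y => v (y, Some true)) s.1 else v s.
Proof.
have -> : refl (embed w) v = fun s => v s -
    ((2 / nrm2 w)%:C)%C * ip w (fun y => v (y, Some true)) * embed w s.
  apply/funext => s; rewrite /refl; congr (_ - (((2 / _)%:C)%C * _) * _).
    rewrite /nrm2 sum_sector; apply: eq_bigr => y _.
    by rewrite /embed /= sqn0 !add0r.
  rewrite /ip sum_sector; apply: eq_bigr => y _.
  rewrite (_ : embed w (y, None) = 0) // (_ : embed w (y, Some false) = 0) //.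
  by rewrite conjc0 !mul0r !add0r.
by apply/funext => -[y [[]|]]; rewrite /embed //= mulr0 subr0.
Qed.

Section Query.
Variable U : qop R 'I_d.
Hypothesis Uu : unitary_op U.

Definition bquery b (v : base -> C) : base -> C :=
  fun y => query U b (fun s : reg d unit => v s.1) (y, tt).

Lemma query_sector K b (v : reg d K -> C) y k :
  query U b v (y, k) = bquery b (fun y => v (y, k)) y.
Proof. by []. Qed.

Lemma bquery_inv v : bquery true (bquery false v) = v.
Proof.
apply/funext => y; rewrite /bquery.
have -> : (fun s : reg d unit => query U false (fun s => v s.1) (s.1, tt)) =
  query U false (fun s : reg d unit => v s.1).
  by apply/funext => -[y' []].
by rewrite query_inv.
Qed.

Lemma isometry_bquery b : isometry (bquery b).
Proof.
have [lq iq] := isometry_query unit b Uu.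
split=> [c u v|u v].
  by apply/funext => y; rewrite /bquery (lq c (fun s => u s.1) (fun s => v s.1)).
have E (F : base -> C) : \sum_y F y = \sum_(s : reg d unit) F s.1.
  rewrite (reindex (fun s : reg d unit => s.1)) //=.
  by exists (fun y => (y, tt)) => [[y []]|].
rewrite /ip !E; apply: etrans (iq (fun s => u s.1) (fun s => v s.1)).
by apply: eq_bigr => -[y []] _.
Qed.

Lemma refl_conj w v :
  bquery true (refl w (bquery false v)) = refl (bquery true w) v.
Proof.
rewrite refl_add (isometry_bquery true).1 bquery_inv refl_add.
rewrite isometry_nrm2; last exact: isometry_bquery.
by rewrite -(isometry_bquery true).2 bquery_inv.
Qed.

End Query.

Definition ext (e : 'I_d -> C) (y : base) : C :=
  if y.1 == ord0 then (y.2 == x0)%:R else e y.2.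

Lemma sum_base (V : nmodType) (F : base -> V) :
  \sum_y F y = \sum_x F (ord0, x) + \sum_x F (ord_max, x).
Proof.
rewrite (eq_bigr (fun y => F (y.1, y.2))) => [|[]//].
rewrite -(pair_bigA _ (fun c x => F (c, x))) /= big_ord_recl big_ord1.
by congr (_ + _); apply: eq_bigr => x _; congr (F (_, _)); exact: val_inj.
Qed.

Lemma nrm2_ext e : nrm2 (ext e) = 1 + \sum_x sqn (e x).
Proof.
rewrite /nrm2 sum_base /ext /=; congr (_ + _).
rewrite (bigD1 x0) //= eqxx sqn1 big1 ?addr0 // => x /negbTE ->; exact: sqn0.
Qed.

Lemma nrm2_ext_ge1 e : 1 <= nrm2 (ext e).
Proof. by rewrite nrm2_ext lerDl; apply: sumr_ge0 => x _; exact: sqn_ge0. Qed.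

Definition extn e : R := Num.sqrt (nrm2 (ext e)).

Lemma extn_ge1 e : 1 <= extn e.
Proof. by rewrite -[1]sqrtr1 ler_wsqrtr // nrm2_ext_ge1. Qed.

Definition guess e (y : base) : C := ((extn e)^-1%:C)%C * ext e y.

Lemma nrm2_guess e : nrm2 (guess e) = 1.
Proof.
have := nrm2_ext_ge1 e => h; rewrite nrm2Z sqnR exprVn sqr_sqrtr ?nrm2_ge0 //.
by rewrite mulVf // gt_eqF // (lt_le_trans ltr01).
Qed.

(** Reference probabilities are the average of those of the guess and of the uniform law on the
    [2 d] labels. The uniform half keeps each weight above [1 / (2 sqrt d)]; the two halves dominate
    the two terms of [amplitude_bound]. *)
Definition weight e (y : base) : R := Num.sqrt ((sqn (guess e y) + (2 * d%:R)^-1) / 2).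

Lemma weight_sqr e y : weight e y ^+ 2 = (sqn (guess e y) + (2 * d%:R)^-1) / 2.
Proof. by rewrite sqr_sqrtr // divr_ge0 // addr_ge0 ?sqn_ge0 // invr_ge0 mulr_ge0. Qed.

Lemma weight1 e : \sum_y weight e y ^+ 2 = 1.
Proof.
under eq_bigr => y _ do rewrite weight_sqr.
rewrite -mulr_suml big_split /= -/(nrm2 _) nrm2_guess sumr_const card_prod !card_ord.
have d0 : (d%:R : R) != 0 by rewrite pnatr_eq0; case: d x0 => [[]|].
by rewrite -[X in 1 + X]mulr_natl natrM; field.
Qed.

Definition start (y : base) : C := rh R * (y.2 == x0)%:R.

Definition target U : base -> C := bquery U true start.

Lemma target0 U x : target U (ord0, x) = rh R * (x == x0)%:R.
Proof. by []. Qed.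

Lemma target1 U x : target U (ord_max, x) = rh R * U x x0.
Proof.
rewrite /target /bquery /query /= (bigD1 x0) //= big1 ?addr0.
  by rewrite /start /= eqxx mulr1 mulrC.
by move=> x' /negbTE h; rewrite /start /= h !mulr0.
Qed.

Lemma nrm2_start : nrm2 start = 1.
Proof.
rewrite nrm2Z sqn_rh /nrm2 sum_base /=.
have -> : \sum_(x : 'I_d) sqn ((x == x0)%:R : C) = 1.
  by rewrite (bigD1 x0) //= eqxx sqn1 big1 ?addr0 // => x /negbTE ->; exact: sqn0.
by field.
Qed.

Lemma nrm2_target U : unitary_op U -> nrm2 (target U) = 1.
Proof. by move=> Uu; rewrite isometry_nrm2 ?nrm2_start //; exact: isometry_bquery. Qed.

(** Difference of the guess in the sector [Some true] and the guess in the sector [None]: the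
    reflection in it exchanges the two, and so removes the component along the guess from the
    interfering sector without a measurement. *)
Definition filter_vec e : reg d sector -> C := fun s =>
  match s.2 with Some true => guess e s.1 | Some false => 0 | None => - guess e s.1 end.

Local Notation param := (bool * ('I_d -> C))%type.

Definition round : seq (op R d param sector) :=
  [:: Gate (fun i : param => refl (embed (guess i.2))); Query _ _ _ _ false;
      Gate (fun=> refl (embed start)); Query _ _ _ _ true].

Variable p : nat.

Definition amplified_ops : seq (op R d param sector) :=
  Gate (fun i => refl (fun s => basis R ((ord0, x0), Some true) s -
         superposed i.1 (weight i.2) (guess i.2) s)) ::
  flatten (nseq p round) ++ [:: Gate (fun i => refl (filter_vec i.2))].

Lemma amplified_wf : wf_ops amplified_ops.
Proof.
split; first by move=> i; exact: isometry_refl.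
apply: wf_cat; last by split=> // i; exact: isometry_refl.
elim: p => //= n IH; split; first by move=> i; exact: isometry_refl.
by split=> //; split=> // i; exact: isometry_refl.
Qed.

Definition amplified := interf (Interferometer ((ord0, x0), Some true) amplified_wf).

Lemma nq_amplified : nq amplified = (2 * p)%N.
Proof.
rewrite nq_interf /= count_cat /= !addn0 add0n; elim: p => //= n ->.
by rewrite mulnS.
Qed.

Variables (b : bool) (e : 'I_d -> C) (U : qop R 'I_d).
Hypothesis Uu : unitary_op U.

Lemma refl_superposed w a v :
  refl (embed w) (superposed b a v) = superposed b a (refl w v).
Proof.
rewrite refl_embed; apply/funext => -[y [[]|]] //=.
by rewrite -[RHS]/((fun y => rh R * refl w v y) y) -reflZ.
Qed.

(** Outside the studied sector the inverse query and the query cancel; inside it they conjugate the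
    reflection about [start] into the one about [target U]. *)
Lemma run_round a v :
  run (b, e) U round (superposed b a v) =
  superposed b a (refl (target U) (refl (guess e) v)).
Proof.
rewrite /run /= refl_superposed.
apply/funext => -[y k]; rewrite query_sector refl_embed.
case: k => [[]|] /=.
- transitivity (bquery U true (refl start (bquery U false
    (fun y => rh R * refl (guess e) v y))) y) => //.
  by rewrite refl_conj // reflZ.
- transitivity (bquery U true (bquery U false (fun y => rh R * (quad R b * ((a y)%:C)%C))) y) => //.
  by rewrite bquery_inv.
- transitivity (bquery U true (bquery U false (fun=> 0)) y) => //.
  by rewrite bquery_inv.
Qed.

Lemma run_rounds n a v :
  run (b, e) U (flatten (nseq n round)) (superposed b a v) =
  superposed b a (iter n (refl (target U) \o refl (guess e)) v).
Proof.
elim: n v => [//|n IH] v.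
have -> : flatten (nseq n.+1 round) = round ++ flatten (nseq n round) by [].
rewrite /run foldl_cat -!/(run _ _ _ _).
by rewrite run_round IH -iterSr.
Qed.

Lemma guess0 : Im (guess e (ord0, x0)) = 0.
Proof. by rewrite /guess /ext /= eqxx mulr1. Qed.

Let phi := guess e.
Let psi := target U.
Let z := ip phi psi.
Let om := fun y => psi y - z * phi y.
Let g := run (b, e) U amplified_ops (basis R ((ord0, x0), Some true)).

Lemma amplified_state (al be : R) :
  iter p (refl psi \o refl phi) phi =
    (fun y => ((al)%:C)%C * phi y + ((be)%:C)%C * conjc z * om y) ->
  forall y, g (y, Some false) = rh R * (quad R b * ((weight e y)%:C)%C) /\
    g (y, Some true) = rh R * (((be)%:C)%C * conjc z * om y).
Proof.
move=> E y.
have -> : g = refl (filter_vec e) (superposed b (weight e)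
    (fun y => ((al)%:C)%C * phi y + ((be)%:C)%C * conjc z * om y)).
  rewrite /g /run /= prepare_superposed ?weight1 ?nrm2_guess ?guess0 //.
  by rewrite foldl_cat -!/(run _ _ _ _) run_rounds E.
rewrite /refl.
have -> : nrm2 (filter_vec e) = 2.
  rewrite /nrm2 sum_sector /filter_vec /=.
  under eq_bigr => y' _ do rewrite sqnN sqn0 add0r.
  by rewrite big_split /= -/(nrm2 _) nrm2_guess.
have -> : ip (filter_vec e) (superposed b (weight e)
    (fun y => ((al)%:C)%C * phi y + ((be)%:C)%C * conjc z * om y)) = rh R * ((al)%:C)%C.
  have ipE : ip phi (fun y => ((al)%:C)%C * phi y + ((be)%:C)%C * conjc z * om y) = ((al)%:C)%C.
    rewrite ipDr ip_nrm2 nrm2_guess mulr1.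
    rewrite (_ : (fun y => _ * om y) = fun y => ((be)%:C)%C * conjc z * om y + (fun=> 0) y).
      rewrite ipDr ip_phi_om ?nrm2_guess // mulr0 add0r /ip big1 ?addr0 // => t _.
      by rewrite mulr0.
    by apply/funext => t; rewrite addr0.
  transitivity (rh R * ip phi (fun y => ((al)%:C)%C * phi y + ((be)%:C)%C * conjc z * om y)).
    rewrite /ip sum_sector mulr_sumr; apply: eq_bigr => t _.
    rewrite (_ : filter_vec e (t, Some false) = 0) // (_ : superposed _ _ _ (t, None) = 0) //.
    by rewrite conjc0 mulr0 mul0r !add0r /superposed /= mulrCA.
  by rewrite ipE.
rewrite divff // mul1r; split; rewrite /superposed /filter_vec /=.
  by rewrite mulr0 subr0.
by rewrite -/phi; ring.
Qed.

Let P := Interferometer ((ord0, x0), Some true) amplified_wf.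

Lemma Ex_amplified (al be : R) y :
  iter p (refl psi \o refl phi) phi =
    (fun y => ((al)%:C)%C * phi y + ((be)%:C)%C * conjc z * om y) ->
  Ex amplified (b, e) U (contrast R y) =
    weight e y * part b (((be)%:C)%C * conjc z * om y).
Proof.
move=> /amplified_state/(_ y) [gA gB].
by rewrite (Ex_contrast (P := P) gA gB) Re_quad.
Qed.

Lemma Ex_amplified2 (al be : R) y :
  iter p (refl psi \o refl phi) phi =
    (fun y => ((al)%:C)%C * phi y + ((be)%:C)%C * conjc z * om y) ->
  Ex amplified (b, e) U (fun o => contrast R y o ^+ 2) =
    (weight e y ^+ 2 + sqn (((be)%:C)%C * conjc z * om y)) / 2.
Proof.
move=> /amplified_state/(_ y) [gA gB].
by rewrite (Ex_contrast2 (P := P) gA gB) [in X in X + _]sqnM sqn_quad mul1r sqnR.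
Qed.

End Amplification.

(** * Estimation in the sup norm *)

Section Probability.
Variables (R : realType) (d : nat) (I : Type) (U : qop R 'I_d).
Hypothesis Uu : unitary_op U.

Lemma Ex_union (O J : finType) (X : expt R d I O) i (P : J -> pred O) (c : R) :
  (forall j, Ex X i U (fun o => ind (~~ P j o)) <= c) ->
  Ex X i U (fun o => ind (~~ [forall j, P j o])) <= #|J|%:R * c.
Proof.
move=> h; apply: (@le_trans _ _ (\sum_j Ex X i U (fun o => ind (~~ P j o)))); last first.
  by rewrite mulr_natl -sumr_const; apply: ler_sum.
rewrite -(Ex_sum X i U predT); apply: Ex_le => o.
case: (boolP [forall j, P j o]) => [_|]; first by apply: sumr_ge0.
rewrite negb_forall => /existsP [j Pj]; rewrite (bigD1 j) //= Pj lerDl.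
by apply: sumr_ge0.
Qed.

Lemma Ex_bind_fail (O1 O2 : finType) (X : expt R d I O1) (Y : expt R d (I * O1) O2) i
    (bad1 : pred O1) (bad : pred (O1 * O2)) (d1 d2 : R) :
  0 <= d2 -> Ex X i U (fun o => ind (bad1 o)) <= d1 ->
  (forall o1, ~~ bad1 o1 -> Ex Y (i, o1) U (fun o2 => ind (bad (o1, o2))) <= d2) ->
  Ex (bind X Y) i U (fun o => ind (bad o)) <= d1 + d2.
Proof.
move=> d20 h1 h2; rewrite Ex_bind //.
apply: (@le_trans _ _ (Ex X i U (fun o1 => ind (bad1 o1) + d2))).
  apply: Ex_le => o1; case: (boolP (bad1 o1)) => [_|/h2 h]; last by rewrite add0r.
  apply: le_trans (_ : 1 <= _); last by rewrite lerDl.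
  rewrite -[leRHS](Ex_cst Y (i, o1) 1 Uu); apply: Ex_le => o2.
  by case: (bad (o1, o2)).
by rewrite ExD Ex_cst // lerD2r.
Qed.

End Probability.

Section Quadratures.
Variables (R : realType) (d : nat) (hd : (0 < d)%N) (I : Type).
Local Notation C := R[i].
Local Notation base := ('I_2 * 'I_d)%type.
Local Notation sector := (option bool).
Local Notation outc := (reg d sector).
Variable X : expt R d (bool * I) outc.

Definition quadratures N : expt R d I (N.-tuple outc * N.-tuple outc)%type :=
  bind (reparam (fun i => (false, i)) (rep hd X N))
       (reparam (fun io => (true, io.1)) (rep hd X N)).

Lemma nq_quadratures N : nq (quadratures N) = (2 * (N * nq X))%N.
Proof. by rewrite nq_bind !nq_reparam !nq_rep mul2n addnn. Qed.

Definition amplitude_est N (a : R) (y : base) (o : N.-tuple outc * N.-tuple outc) : C :=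
  Complex ((\sum_(r <- o.1) contrast R y r) / (N%:R * a))
          ((\sum_(r <- o.2) contrast R y r) / (N%:R * a)).

Variables (i : I) (U : qop R 'I_d) (s : R).
Hypothesis Uu : unitary_op U.
Hypothesis s0 : 0 < s.

(** [sqn B <= 4 a^2] bounds the second moment [(a^2 + |B|^2) / 2] by the [5/2 a^2] of
    [concentration]. The error [2 s] adds those of the real and imaginary parts; the factor 4 counts
    two parts and two tails. *)
Lemma quadratures_fail1 N (a : R) (B : C) y : (0 < N)%N ->
  0 < a -> s <= 5 * a -> sqn B <= 4 * a ^+ 2 ->
  (forall b, Ex X (b, i) U (contrast R y) = a * part b B) ->
  (forall b, Ex X (b, i) U (fun o => contrast R y o ^+ 2) = (a ^+ 2 + sqn B) / 2) ->
  Ex (quadratures N) i U (fun o => ind (~~ (cabs (amplitude_est a y o - B) <= 2 * s)))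
    <= 4 * expR (- (N%:R * (s ^+ 2 / 20))).
Proof.
move=> N0 a0 sa Ba m1 m2; set E := expR _.
have -> : 4 * E = 2 * E + 2 * E by ring.
have NR : 0 < N%:R :> R by rewrite ltr0n.
have var b : Ex X (b, i) U (fun o => contrast R y o ^+ 2) <= 5 / 2 * a ^+ 2.
  by rewrite m2; lra.
have conc b := concentration hd Uu N (contrast_le1 R y) a0 s0 sa (var b).
pose off b (os : N.-tuple outc) :=
  ~~ (`|\sum_(o <- os) contrast R y o - N%:R * (a * part b B)| <= N%:R * (a * s)).
apply: (Ex_bind_fail Uu (bad1 := off false)) => //.
- by rewrite mulr_ge0 // expR_ge0.
- by rewrite Ex_reparam; have := conc false; rewrite m1.
move=> o1 ok1; rewrite Ex_reparam /=.
apply: le_trans (_ : Ex (rep hd X N) (true, i) U (fun os => ind (off true os)) <= _).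
  apply: Ex_le => o2; apply: ind_le; apply: contraNN => ok2.
  have scale os b : ~~ off b os ->
      `|(\sum_(r <- os) contrast R y r) / (N%:R * a) - part b B| <= s.
    rewrite negbK => h; have Na : 0 < N%:R * a by rewrite mulr_gt0.
    rewrite -(ler_pM2l Na) -[X in X * `|_| <= _](gtr0_norm Na) -normrM mulrBr.
    by rewrite [N%:R * a * (_ / _)]mulrC divfK ?gt_eqF // -!mulrA.
  rewrite /amplitude_est; apply: (le_trans (cabs_ReIm _)).
  have := lerD (scale o1 false ok1) (scale o2 true _); rewrite negbK => /(_ ok2) h.
  rewrite [2 * s]mulr_natl mulr2n; apply: le_trans h.
  by case: (B) => p q.
by have := conc true; rewrite m1.
Qed.

End Quadratures.

Section Estimators.
Variables (R : realType) (d : nat) (hd : (0 < d)%N).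
Local Notation C := R[i].
Local Notation x0 := (Ordinal hd).

Definition close (eps : R) (e : 'I_d -> C) (U : qop R 'I_d) : bool :=
  [forall x, cabs (e x - U x x0) <= eps].

Definition estimator (Q : nat) (eps delta : R) :=
  exists (O : finType) (X : expt R d unit O) (est : O -> 'I_d -> C),
    nq X = Q /\ forall U, unitary_op U ->
      Ex X tt U (fun o => ind (~~ close eps (est o) U)) <= delta.

Lemma estimatorW Q eps eps' delta delta' : eps <= eps' -> delta <= delta' ->
  estimator Q eps delta -> estimator Q eps' delta'.
Proof.
move=> lee led [T [X [est [nX h]]]]; exists T, X, est; split=> // U Uu.
apply: le_trans (le_trans (h U Uu) led); apply: Ex_le => o; apply: ind_le.
apply: contraNN => /forallP c; apply/forallP => x; exact: le_trans (c x) lee.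
Qed.

Lemma sqn_column (U : qop R 'I_d) : unitary_op U -> \sum_x sqn (U x x0) = 1.
Proof.
move=> Uu; apply: complexI; rewrite rmorph_sum rmorph1 /=.
transitivity (\sum_l cconj (U l x0) * U l x0); last by rewrite Uu eqxx.
apply: eq_bigr => x _.
by rewrite /cconj conjcMz.
Qed.

Lemma sqn_entry (U : qop R 'I_d) x : unitary_op U -> sqn (U x x0) <= 1.
Proof.
move=> /sqn_column <-; rewrite (bigD1 x) //= lerDl.
by apply: sumr_ge0 => y _; exact: sqn_ge0.
Qed.

Definition meas : expt R d unit 'I_d :=
  @Expt R d unit 'I_d unit ((ord_max, x0), tt) [:: Query _ _ _ _ true]
    (fun s => s.1.2) (conj Logic.I Logic.I).

Lemma Ex_meas U f : Ex meas tt U f = \sum_x sqn (U x x0) * f x.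
Proof.
rewrite /Ex (reindex (fun y : 'I_2 * 'I_d => (y, tt) : reg d unit)) /=; last first.
  by exists (fun s => s.1) => // -[y []].
rewrite sum_base [X in X + _]big1 ?add0r.
  apply: eq_bigr => x _; congr (sqn _ * _).
  rewrite /amp /run /= /query /= (bigD1 x0) //= big1 ?addr0.
    by rewrite /basis eqxx mulr1.
  by move=> x' /negbTE x'x; rewrite /basis !xpair_eqE x'x andbF /= mulr0.
by move=> x _; rewrite /amp /run /= /query /= sqn0 mul0r.
Qed.

Definition freq N (os : N.-tuple 'I_d) (x : 'I_d) : R := (count (pred1 x) os)%:R / N%:R.

Lemma freq_sum N (os : N.-tuple 'I_d) : (0 < N)%N -> \sum_x freq os x = 1.
Proof.
move=> N0; rewrite -mulr_suml -natr_sum.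
have -> : (\sum_x count (pred1 x) os = N)%N.
  rewrite -{2}(size_tuple os) -sum1_size.
  under eq_bigr => x _ do rewrite -sum1_count big_mkcond.
  rewrite exchange_big /=; apply: eq_bigr => o _.
  by rewrite (bigD1 o) //= eqxx big1 // => x /negbTE; rewrite eq_sym => ->.
by rewrite divff // pnatr_eq0 -lt0n.
Qed.

Lemma freq_ge0 N (os : N.-tuple 'I_d) x : 0 <= freq os x.
Proof. by rewrite divr_ge0. Qed.

Definition root_freq N (os : N.-tuple 'I_d) (x : 'I_d) : R := Num.sqrt (freq os x).

Lemma root_freq_sqr N (os : N.-tuple 'I_d) x : root_freq os x ^+ 2 = freq os x.
Proof. by rewrite sqr_sqrtr // freq_ge0. Qed.

(* Measured frequencies tell which amplitudes are not negligible and serve as the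
   reference against which these amplitudes are then interfered. *)
Lemma direct_estimator N eps delta : (0 < N)%N -> 0 < eps ->
  5 * d%:R * expR (- (N%:R * (eps ^+ 2 / 80))) <= delta ->
  estimator (3 * N) eps delta.
Proof.
move=> N0 e0 hdelta.
have NR : 0 < N%:R :> R by rewrite ltr0n.
pose D := quadratures hd (direct R x0) N.
pose Y := reparam (fun io : unit * N.-tuple 'I_d => root_freq io.2) D.
(* If every label of probability at least [eps^2] has at least half its expected frequency, a label
   below this threshold may be answered by 0, and one above it has probability at most twice its
   frequency. *)
pose heavy (os : N.-tuple 'I_d) x := eps ^+ 2 / 2 <= freq os x.
exists _, (bind (rep hd meas N) Y), (fun o x =>
  if heavy o.1 x then amplitude_est (root_freq o.1 x) (ord0, x) o.2 else 0).
split.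
  by rewrite nq_bind nq_rep nq_reparam nq_quadratures nq_direct /nq /= !muln1 mulSn.
move=> U Uu; set E := expR _ in hdelta.
have E0 : 0 <= E by exact: expR_ge0.
apply: le_trans (_ : d%:R * E + d%:R * (4 * E) <= _); last by lra.
pose tail (os : N.-tuple 'I_d) x := (eps ^+ 2 <= sqn (U x x0)) ==>
  (N%:R * sqn (U x x0) / 2 <= (count (pred1 x) os)%:R).
apply: (Ex_bind_fail Uu (bad1 := fun os => ~~ [forall x, tail os x])).
- by rewrite !mulr_ge0.
- rewrite -[X in X%:R * E](card_ord d); apply: Ex_union => // x.
  rewrite /tail; case: (leP (eps ^+ 2) (sqn (U x x0))) => hx /=; last first.
    by apply: le_trans E0; rewrite /Ex big1 // => s _; rewrite mulr0.
  have mE : Ex meas tt U (fun o => ind (pred1 x o)) = sqn (U x x0).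
    rewrite Ex_meas (bigD1 x) //= eqxx mulr1 big1 ?addr0 // => x' /negbTE ->.
    by rewrite mulr0.
  have := @lower_tail _ _ hd _ _ meas tt _ Uu (pred1 x) (eps ^+ 2) N.
  rewrite mE => /(_ hx) h; apply: (le_trans h).
  rewrite ler_expR lerN2 ler_wpM2l ?ler0n // ler_wpM2l ?sqr_ge0 //.
  by rewrite lef_pV2 ?posrE // ler_nat.
move=> o1; rewrite negbK => /forallP ok1; rewrite Ex_reparam /=.
have half_freq x : eps ^+ 2 <= sqn (U x x0) -> sqn (U x x0) / 2 <= freq o1 x.
  move=> h; have := ok1 x; rewrite /tail h /= /freq ler_pdivlMr //; lra.
have psi_freq x : heavy o1 x -> sqn (U x x0) <= 2 * freq o1 x.
  rewrite /heavy => hx; case: (leP (eps ^+ 2) (sqn (U x x0))) => h; last by lra.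
  have := half_freq x h; lra.
pose P (x : 'I_d) (o2 : N.-tuple (reg d (option bool)) * N.-tuple (reg d (option bool))) :=
  heavy o1 x ==> (cabs (amplitude_est (root_freq o1 x) (ord0, x) o2 - U x x0) <= eps).
apply: le_trans (_ : Ex D (root_freq o1) U (fun o2 => ind (~~ [forall x, P x o2])) <= _).
  apply: Ex_le => o2; apply: ind_le; apply: contraNN => /forallP ok2.
  apply/forallP => x; have := ok2 x; rewrite /P; case: ifP => //= hx _.
  rewrite sub0r cabsN cabs_leP ?(ltW e0) // leNgt; apply/negP => h.
  by have := half_freq x (ltW h); move/negbT: hx; rewrite /heavy -ltNge; lra.
rewrite -[X in X%:R * _](card_ord d); apply: Ex_union => // x.
rewrite /P; case: (boolP (heavy o1 x)) => hx /=; last first.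
  by apply: le_trans (mulr_ge0 _ E0) => //; rewrite /Ex big1 // => s _; rewrite mulr0.
have hf := psi_freq _ hx; rewrite /heavy in hx.
have r0 : 0 < root_freq o1 x.
  by rewrite sqrtr_gt0; apply: lt_le_trans hx; rewrite divr_gt0 // exprn_gt0.
have a1 : \sum_x root_freq o1 x ^+ 2 = 1.
  by under eq_bigr => y _ do rewrite root_freq_sqr; exact: freq_sum.
have e2 : 0 < eps / 2 by lra.
have := @quadratures_fail1 _ _ hd _ (direct R x0) (root_freq o1) U (eps / 2) Uu e2 N
  (root_freq o1 x) (U x x0) (ord0, x) N0 r0.
have -> : 2 * (eps / 2) = eps by field.
have -> : (eps / 2) ^+ 2 / 20 = eps ^+ 2 / 80 by field.
apply.
- have : eps / 2 <= root_freq o1 x; last by lra.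
  rewrite -(ler_pXn2r (_ : 0 < 2)%N) ?nnegrE ?(ltW e2) ?(ltW r0) // root_freq_sqr.
  have := sqr_ge0 eps; nra.
- by rewrite root_freq_sqr; have := freq_ge0 o1 x; lra.
- by move=> b; exact: Ex_direct.
- by move=> b; exact: Ex_direct2.
Qed.

End Estimators.

(** * Halving the error of an estimate *)

Section Refinement.
Variables (R : realType) (d : nat) (hd : (0 < d)%N).
Local Notation C := R[i].
Local Notation base := ('I_2 * 'I_d)%type.
Local Notation x0 := (Ordinal hd).
Local Notation sd := (Num.sqrt (d%:R : R)).

Lemma sqrt_dim_sqr : sd ^+ 2 = d%:R.
Proof. by rewrite sqr_sqrtr. Qed.

Lemma sqrt_dim_ge1 : 1 <= sd.
Proof. by rewrite -[leLHS]sqrtr1; apply: ler_wsqrtr; rewrite ler1n. Qed.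

Section Deterministic.
Variables (p : nat) (e : 'I_d -> C) (U : qop R 'I_d) (be : R).
Hypotheses (Uu : unitary_op U) (p8 : (8 <= p)%N).
Let P : R := p%:R.
Let eps : R := (2 * P * sd)^-1.
(** Bound on the Euclidean norm of the error of [e]. Since [eta * P = 1/2], one has
    [S * P^2 <= 1/8], and the [p] rounds stay where the magnification is nearly linear. *)
Let eta : R := (2 * P)^-1.
Hypothesis close_e : forall x, cabs (e x - U x x0) <= eps.

Let phi := guess x0 e.
Let psi := target x0 U.
Let z := ip phi psi.
Let om := fun y => psi y - z * phi y.
Let S := nrm2 om.
Hypothesis be_ub : `|be| <= 2 * P.
Hypothesis be_close : `|be - 2 * P| <= 4 / 3 * S * P ^+ 3.
Let B y := ((be)%:C)%C * conjc z * om y.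
(** Undoes the normalization of the guess: [psi - c phi] vanishes on the first row and is the error
    of [e], up to [1 / sqrt 2], on the second. *)
Let c : C := rh R * ((extn x0 e)%:C)%C.

Lemma P_ge8 : 8 <= P.
Proof. by rewrite /P ler_nat. Qed.

Lemma eta_eps : eta = eps * sd.
Proof.
have := P_ge8; have := sqrt_dim_ge1 => h1 h2; rewrite /eta /eps.
by field; apply/andP; split; rewrite gt_eqF //; lra.
Qed.

Lemma eta_bounds : 0 < eta /\ eta <= 1 / 16 /\ eta * P = 1 / 2.
Proof.
have h := P_ge8; have PP : 0 < 2 * P by lra.
split; first by rewrite invr_gt0.
split; last by rewrite /eta; field; rewrite gt_eqF //; lra.
by rewrite -[1 / 16]invrK lef_pV2 ?posrE ?invr_gt0 //; lra.
Qed.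

Lemma eps_bounds : 0 < eps /\ eps <= eta.
Proof.
have [e0 _] := eta_bounds; have h := sqrt_dim_ge1.
have PP : 0 < 2 * P by have := P_ge8; lra.
have eps0 : 0 < eps by rewrite invr_gt0 mulr_gt0 //; lra.
by split=> //; rewrite eta_eps ler_peMr // ltW.
Qed.

Lemma scaled_guess y : c * phi y = rh R * ext x0 e y.
Proof.
rewrite /c /phi /guess -!mulrA; congr (_ * _); rewrite mulrA -rmorphM /= divff ?mul1r //.
by rewrite gt_eqF // (lt_le_trans ltr01) // extn_ge1.
Qed.

Lemma target_gap0 x : psi (ord0, x) - c * phi (ord0, x) = 0.
Proof. by rewrite scaled_guess /psi target0 /ext /= subrr. Qed.

Lemma target_gap1 x : psi (ord_max, x) - c * phi (ord_max, x) = rh R * (U x x0 - e x).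
Proof. by rewrite scaled_guess /psi target1 /ext /= mulrBr. Qed.

Lemma sqn_close x : sqn (U x x0 - e x) <= eps ^+ 2.
Proof. by rewrite -cabs_leP ?(ltW eps_bounds.1) // cabsB. Qed.

Lemma sqn_gap y : sqn (psi y - c * phi y) <= eps ^+ 2 / 2.
Proof.
case: y => k x; have [->|k1] : k = ord0 \/ k = ord_max.
    by case: k => -[|[|//]] h; [left|right]; exact: val_inj.
  by rewrite target_gap0 sqn0 divr_ge0 // sqr_ge0.
by rewrite k1 target_gap1 sqnM sqn_rh; have := sqn_close x; lra.
Qed.

Lemma gap_split : S + sqn (z - c) <= eta ^+ 2 / 2.
Proof.
rewrite -nrm2_sub_proj ?nrm2_guess ?nrm2_target // /nrm2 sum_base.
rewrite big1 => [|x _]; last by rewrite target_gap0 sqn0.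
rewrite add0r eta_eps exprMn sqrt_dim_sqr.
have -> : eps ^+ 2 * d%:R / 2 = \sum_(x < d) (eps ^+ 2 / 2).
  by rewrite sumr_const card_ord -mulr_natr; ring.
apply: ler_sum => x _; exact: sqn_gap.
Qed.

Lemma S_bounds : 0 <= S /\ S <= eta ^+ 2 / 2.
Proof.
split; first exact: nrm2_ge0.
by have := gap_split; have := sqn_ge0 (z - c); lra.
Qed.

Lemma zc_bound : sqn (z - c) <= eta ^+ 2 / 2.
Proof. by have := gap_split; have := S_bounds; lra. Qed.

Lemma sqn_z : sqn z = 1 - S.
Proof. by rewrite /z sqn_overlap ?nrm2_guess ?nrm2_target. Qed.

Lemma cabs_zc : cabs (z - c) <= 3 / 4 * eta.
Proof.
have [e0 _] := eta_bounds; rewrite cabs_leP ?mulr_ge0 ?(ltW e0) //.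
by have := zc_bound; have := sqr_ge0 eta; lra.
Qed.

(** [z] is close to the nonnegative real [c], and its modulus is close to 1 because [S] is small; so
    its phase is nearly trivial as well. *)
Lemma cabs_z1 : cabs (z - 1) <= 1 / 10.
Proof.
have [e0 [e16 _]] := eta_bounds; have zc := cabs_zc.
pose r : R := (Num.sqrt 2)^-1 * extn x0 e.
have cr : c = (r%:C)%C by rewrite /c /rh -rmorphM.
have r0 : 0 <= r by rewrite mulr_ge0 ?invr_ge0 ?sqrtr_ge0.
have z0 := cabs_ge0 z.
have z2 : cabs z ^+ 2 = 1 - S by rewrite cabs_sqr sqn_z.
have [S0 S1] := S_bounds.
have zle : cabs z <= 1 by nra.
have zge : 1 - eta / 16 <= cabs z by nra.
have rc : cabs c = r by rewrite cr cabsR ger0_norm.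
have ru : r <= cabs z + 3 / 4 * eta.
  rewrite -rc (_ : c = z + (c - z)); last by rewrite addrC subrK.
  by apply: (le_trans (cabsD _ _)); rewrite lerD2l cabsB.
have rl : cabs z <= r + 3 / 4 * eta.
  rewrite -rc {1}(_ : z = c + (z - c)); last by rewrite addrC subrK.
  by apply: (le_trans (cabsD _ _)); rewrite lerD2l.
rewrite (_ : z - 1 = (z - c) + (c - 1)); last by rewrite addrA subrK.
apply: (le_trans (cabsD _ _)).
have -> : cabs (c - 1) = `|r - 1|.
  by rewrite cr -(rmorph1 (real_complex R)) -rmorphB cabsR.
have : `|r - 1| <= 13 / 16 * eta by rewrite ler_norml; apply/andP; split; lra.
lra.
Qed.

(** Write [om = (psi - c phi) - (z - c) phi]. The first term is at most of order [eps] at every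
    label, the second of order [eta |phi y|]; magnified by [2 P] they contribute [1/d] and
    [|phi y|^2]. *)
Lemma amplitude_bound y : sqn (B y) <= 4 * weight x0 e y ^+ 2.
Proof.
have [e0 [e16 eP]] := eta_bounds; have [q0 qe] := eps_bounds.
have om_le : sqn (om y) <= eps ^+ 2 + eta ^+ 2 * sqn (phi y).
  rewrite /om (_ : psi y - z * phi y = (psi y - c * phi y) - (z - c) * phi y); last ring.
  apply: (le_trans (sqnD_le _ _)); rewrite sqnN sqnM.
  have := sqn_gap y; have := ler_wpM2r (sqn_ge0 (phi y)) zc_bound; lra.
rewrite /B !sqnM sqnR sqnJ sqn_z weight_sqr.
have [S0 S1] := S_bounds.
have b2 : be ^+ 2 <= 4 * P ^+ 2.
  have -> : 4 * P ^+ 2 = (2 * P) ^+ 2 by ring.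
  by rewrite -[be ^+ 2]real_normK ?num_real // ler_pXn2r // nnegrE ?(le_trans _ be_ub).
have d0 : 0 < d%:R :> R by rewrite ltr0n.
have epsP : eps ^+ 2 * (4 * P ^+ 2) = (d%:R)^-1.
  rewrite -sqrt_dim_sqr /eps; have := P_ge8; have := sqrt_dim_ge1 => h1 h2.
  by field; apply/andP; split; rewrite gt_eqF //; lra.
have om0 := sqn_ge0 (om y); have ph0 := sqn_ge0 (phi y).
have s1 : be ^+ 2 * (1 - S) * sqn (om y) <= 4 * P ^+ 2 * sqn (om y).
  rewrite ler_wpM2r //; have := sqr_ge0 be; nra.
have s2 : 4 * P ^+ 2 * sqn (om y) <= 4 * P ^+ 2 * (eps ^+ 2 + eta ^+ 2 * sqn (phi y)).
  by rewrite ler_wpM2l // mulr_ge0 // sqr_ge0.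
have s3 : 4 * P ^+ 2 * (eps ^+ 2 + eta ^+ 2 * sqn (phi y)) = (d%:R)^-1 + sqn (phi y).
  rewrite mulrDr [X in X + _]mulrC epsP; congr (_ + _).
  have -> : 4 * P ^+ 2 * (eta ^+ 2 * sqn (phi y)) = (2 * (eta * P)) ^+ 2 * sqn (phi y) by ring.
  by rewrite eP; field.
have -> : 4 * ((sqn (guess x0 e y) + (2 * d%:R)^-1) / 2) = 2 * sqn (phi y) + (d%:R)^-1.
  by rewrite -/phi; field; rewrite gt_eqF.
by lra.
Qed.

(* The component of [om] outside the first row singles out the error of [e], free of
   the unknown overlap and normalization. *)
Lemma amplitude_combination x :
  B (ord_max, x) - e x * B (ord0, x0) =
  ((be)%:C)%C * conjc z * rh R * (U x x0 - e x).
Proof.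
rewrite /B /om /phi /guess /psi target0 target1 /ext /=; ring.
Qed.

Variable u : base -> C.
Let s : R := (40 * sd)^-1.
Hypothesis close0 : cabs (u (ord0, x0) - B (ord0, x0)) <= 2 * s.
Hypothesis close1 : forall x, cabs (u (ord_max, x) - B (ord_max, x)) <= 2 * s.

(** The new error is [(U - e) k + w n]. Here [k] gathers the nonlinearity of the magnification
    (1/12) and the overlap (1/10), so the first term costs [eps / 5]. The noise satisfies
    [|n| <= 2 s + 2 * 2 s], and the 40 in [s] makes it cost the remaining [3/10 eps]. *)
Lemma refined_close x :
  cabs (e x + (P^-1%:C)%C * rh R * (u (ord_max, x) - e x * u (ord0, x0)) - U x x0) <= eps / 2.
Proof.
have [e0 [e16 eP]] := eta_bounds; have [q0 qe] := eps_bounds.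
have P8 := P_ge8; have P0 : 0 < P by lra.
have [S0 S1] := S_bounds.
set w := (P^-1%:C)%C * rh R.
set k : C := ((be / (2 * P))%:C)%C * conjc z - 1.
set n : C := (u (ord_max, x) - B (ord_max, x)) - e x * (u (ord0, x0) - B (ord0, x0)).
have -> : e x + w * (u (ord_max, x) - e x * u (ord0, x0)) - U x x0 =
    (U x x0 - e x) * k + w * n.
  have -> : w * (u (ord_max, x) - e x * u (ord0, x0)) =
      w * (B (ord_max, x) - e x * B (ord0, x0)) + w * n by rewrite /n; ring.
  rewrite amplitude_combination.
  have -> : w * (((be)%:C)%C * conjc z * rh R * (U x x0 - e x)) = (k + 1) * (U x x0 - e x).
    rewrite /k subrK /w mulrA; congr (_ * _).
    have -> : ((be / (2 * P))%:C)%C = (P^-1%:C)%C * ((be)%:C)%C * (rh R * rh R).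
      rewrite rh_sqr -(rmorph_nat (real_complex R)) -fmorphV -!rmorphM; congr ((_)%:C)%C.
      by field; rewrite gt_eqF.
    by ring.
  by ring.
apply: (le_trans (cabsD _ _)); rewrite cabsM [cabs (w * n)]cabsM.
have kb : cabs k <= 1 / 5.
  have bP : `|be / (2 * P)| <= 1.
    by rewrite normrM normfV (gtr0_norm (_ : 0 < 2 * P)) ?ler_pdivrMr ?mul1r //; lra.
  have bP1 : `|be / (2 * P) - 1| <= 1 / 12.
    have -> : be / (2 * P) - 1 = (be - 2 * P) / (2 * P) by field; rewrite gt_eqF.
    rewrite normrM normfV (gtr0_norm (_ : 0 < 2 * P)); last by lra.
    rewrite ler_pdivrMr; last by lra.
    apply: (le_trans be_close).
    have -> : 4 / 3 * S * P ^+ 3 = (S * P ^+ 2) * (4 / 3 * P) by ring.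
    have h1 : S * P ^+ 2 <= eta ^+ 2 / 2 * P ^+ 2 by rewrite ler_wpM2r // sqr_ge0.
    have h2 : eta ^+ 2 / 2 * P ^+ 2 = 1 / 8.
      have -> : eta ^+ 2 / 2 * P ^+ 2 = (eta * P) ^+ 2 / 2 by ring.
      by rewrite eP; field.
    rewrite h2 in h1.
    have : S * P ^+ 2 * (4 / 3 * P) <= 1 / 8 * (4 / 3 * P) by apply: ler_wpM2r h1; lra.
    lra.
  rewrite /k (_ : _ - 1 = ((be / (2 * P))%:C)%C * (conjc z - 1) +
      (((be / (2 * P)) - 1)%:C)%C); last by rewrite rmorphB rmorph1; ring.
  apply: (le_trans (cabsD _ _)); rewrite cabsM !cabsR.
  have -> : cabs (conjc z - 1) = cabs (z - 1).
    by rewrite !cabs_sqrt -[in RHS]sqnJ conjcB conjc1.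
  have := cabs_z1; have := cabs_ge0 (z - 1); have := normr_ge0 (be / (2 * P)); nra.
have wb : cabs w <= P^-1.
  rewrite cabsM cabsR ger0_norm ?invr_ge0 ?(ltW P0) // -[leRHS]mulr1.
  by rewrite ler_wpM2l ?invr_ge0 ?(ltW P0) // cabs_leP // sqn_rh expr1n; lra.
have eb : cabs (e x) <= 2.
  rewrite (_ : e x = (e x - U x x0) + U x x0); last by rewrite subrK.
  apply: (le_trans (cabsD _ _)).
  have : cabs (U x x0) <= 1 by rewrite cabs_leP // expr1n sqn_entry.
  by have := close_e x; lra.
have s0 : 0 < s by rewrite invr_gt0 mulr_gt0 //; have := sqrt_dim_ge1; lra.
have nb : cabs n <= 6 * s.
  apply: (le_trans (cabsD _ _)); rewrite cabsN cabsM.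
  have := close1 x; have := cabs_ge0 (u (ord0, x0) - B (ord0, x0)).
  by have := cabs_ge0 (e x); have := close0; nra.
have t1 : cabs (U x x0 - e x) * cabs k <= eps * (1 / 5).
  by apply: ler_pM; rewrite ?cabs_ge0 // cabsB.
have t2 : cabs w * cabs n <= P^-1 * (6 * s) by apply: ler_pM; rewrite ?cabs_ge0.
have cst : P^-1 * (6 * s) = 3 / 10 * eps.
  rewrite /s /eps; have := sqrt_dim_ge1 => h.
  by field; apply/andP; split; rewrite gt_eqF //; lra.
by apply: (le_trans (lerD t1 t2)); rewrite cst; lra.
Qed.

End Deterministic.

Lemma refine_estimator p N Q d1 d2 : (8 <= p)%N -> (0 < N)%N ->
  estimator hd Q ((2 * p%:R * sd)^-1) d1 ->
  8 * d%:R * expR (- (N%:R * ((20 * 40 ^+ 2 * d%:R)^-1))) <= d2 ->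
  estimator hd (Q + 4 * N * p) ((4 * p%:R * sd)^-1) (d1 + d2).
Proof.
move=> p8 N0 [T [X [est [nX hX]]]] hd2.
pose D := quadratures hd (amplified R x0 p) N.
pose Y := reparam (fun io : unit * T => est io.2) D.
pose s : R := (40 * sd)^-1.
have sd1 := sqrt_dim_ge1.
have s0 : 0 < s by rewrite invr_gt0 mulr_gt0 //; lra.
pose u (o1 : T) (o2 : N.-tuple (reg d (option bool)) * N.-tuple (reg d (option bool)))
  (y : base) := amplitude_est (weight x0 (est o1) y) y o2.
exists _, (bind X Y), (fun o x => est o.1 x + ((p%:R)^-1%:C)%C * rh R *
   (u o.1 o.2 (ord_max, x) - est o.1 x * u o.1 o.2 (ord0, x0))).
split.
  rewrite nq_bind nX nq_reparam nq_quadratures nq_amplified; congr (_ + _)%N.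
  by rewrite (mulnCA N) !mulnA.
move=> U Uu; set E := expR _ in hd2.
have E0 : 0 <= E by exact: expR_ge0.
have d2_ge0 : 0 <= d2 by apply: le_trans hd2; rewrite !mulr_ge0.
apply: (Ex_bind_fail Uu (bad1 := fun o => ~~ close hd ((2 * p%:R * sd)^-1) (est o) U)) => //.
  exact: hX.
move=> o1; rewrite negbK => /forallP ok1; rewrite Ex_reparam /=.
set e := est o1 in ok1 *.
have [al [be [rot [be1 be2]]]] :=
  rotation_power (nrm2_guess x0 e) (nrm2_target x0 Uu) p.
pose B y := ((be)%:C)%C * conjc (ip (guess x0 e) (target x0 U)) *
  (target x0 U y - ip (guess x0 e) (target x0 U) * guess x0 e y).
(* [None] stands for the component whose value in the target is known. The [d + 1] labels, at [4 E]
   each, cost at most [8 d E]. *)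
pose yy (j : option 'I_d) : base := if j is Some x then (ord_max, x) else (ord0, x0).
pose ok j o2 := cabs (u o1 o2 (yy j) - B (yy j)) <= 2 * s.
apply: le_trans (_ : Ex D e U (fun o2 => ind (~~ [forall j, ok j o2])) <= _).
  apply: Ex_le => o2; apply: ind_le; apply: contraNN => /forallP ok2.
  apply/forallP => x.
  have -> : (4 * p%:R * sd)^-1 = (2 * p%:R * sd)^-1 / 2.
    have : 0 < p%:R :> R by rewrite ltr0n (leq_trans _ p8).
    by move=> hp; field; apply/andP; split; rewrite gt_eqF //; lra.
  exact: (refined_close Uu p8 ok1 be1 be2 (u := u o1 o2) (ok2 None) (fun x => ok2 (Some x))).
have J : #|{: option 'I_d}|%:R * (4 * E) <= d2.
  rewrite card_option card_ord -natr1; apply: le_trans hd2.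
  have : 1 <= d%:R :> R by rewrite ler1n.
  nra.
apply: le_trans J; apply: Ex_union => // j.
have wpos : 0 < weight x0 e (yy j) /\ s <= 5 * weight x0 e (yy j).
  have d0 : 0 < d%:R :> R by rewrite ltr0n.
  have w2 : (4 * d%:R)^-1 <= weight x0 e (yy j) ^+ 2.
    rewrite weight_sqr (_ : (4 * d%:R)^-1 = (2 * d%:R)^-1 / 2 :> R); last first.
      by field; rewrite gt_eqF.
    by rewrite ler_pM2r // lerDr sqn_ge0.
  have w1 : (2 * sd)^-1 <= weight x0 e (yy j).
    rewrite -(ler_pXn2r (_ : 0 < 2)%N) ?nnegrE ?invr_ge0 ?mulr_ge0 ?sqrtr_ge0 //.
    by rewrite exprVn exprMn sqrt_dim_sqr -natrX.
  have ss : 0 < (2 * sd)^-1 by rewrite invr_gt0 mulr_gt0 //; lra.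
  have -> : s = (2 * sd)^-1 / 20 by rewrite /s; field; rewrite gt_eqF //; lra.
  by split; lra.
have := @quadratures_fail1 _ _ hd _ (amplified R x0 p) e U s Uu s0 N
  (weight x0 e (yy j)) (B (yy j)) (yy j) N0 wpos.1 wpos.2.
have -> : s ^+ 2 / 20 = (20 * 40 ^+ 2 * d%:R)^-1.
  by rewrite -sqrt_dim_sqr /s; field; rewrite gt_eqF //; lra.
apply.
- exact: (amplitude_bound Uu p8 ok1 be1).
- by move=> b; exact: (Ex_amplified b Uu _ rot).
- by move=> b; exact: (Ex_amplified2 b Uu _ rot).
Qed.

End Refinement.

(** * Query counts in the sup norm *)

Section SupNorm.
Variables (R : realType) (d : nat) (hd : (0 < d)%N).
Local Notation sd := (Num.sqrt (d%:R : R)).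

(** The 8 absorbs the constants 5 and 8 of the union bounds and keeps the logarithm above 1 in all
    cases. *)
Definition loglen (delta : R) : R := ln (8 * d%:R / delta).

Lemma dim_ge1 : 1 <= d%:R :> R.
Proof. by rewrite ler1n. Qed.

Lemma loglen_ge1 delta : 0 < delta < 1 -> 1 <= loglen delta.
Proof.
move=> /andP[d0 d1]; rewrite -[leLHS](expRK 1) /loglen.
have e8 : expR 1 <= 8 :> R.
  have -> : 1 = 1 / 2 + 1 / 2 :> R by field.
  have h : expR (1 / 2) <= 2 :> R.
    by apply: le_trans (expR_le_quad (lexx _)) _; lra.
  rewrite expRD; have := expR_ge0 (1 / 2 : R); nra.
have le8 : 8 <= 8 * d%:R / delta.
  rewrite ler_pdivlMr //; have := dim_ge1; nra.
rewrite ler_ln ?posrE ?expR_gt0 //; last by apply: lt_le_trans le8.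
exact: le_trans le8.
Qed.

Lemma expR_loglen delta (c x : R) : 0 < delta < 1 -> 0 < c <= 8 -> loglen delta <= x ->
  c * d%:R * expR (- x) <= delta.
Proof.
move=> /andP[d0 d1] /andP[c0 c8] Lx.
have D1 := dim_ge1.
have pos : 0 < 8 * d%:R / delta by rewrite divr_gt0 // mulr_gt0 //; lra.
have : expR (- x) <= delta / (8 * d%:R).
  rewrite -[leRHS]invf_div expRN lef_pV2 ?posrE ?expR_gt0 //.
  by rewrite -[leLHS](lnK pos) ler_expR.
move=> h; apply: le_trans (ler_wpM2l _ h) _; first by rewrite mulr_ge0 //; lra.
have -> : c * d%:R * (delta / (8 * d%:R)) = c / 8 * delta by field; lra.
by rewrite ler_piMl ?(ltW d0) //; lra.
Qed.

Lemma exists_nat (x : R) : 1 <= x -> exists N : nat, [/\ (0 < N)%N, x <= N%:R & N%:R <= 2 * x].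
Proof.
move=> x1; have /andP[h1 h2] := truncn_itv (le_trans ler01 x1).
exists (Num.truncn x).+1; split=> //; first exact: ltW.
by rewrite -natr1; lra.
Qed.

Lemma direct_cost (eps delta : R) : 0 < eps <= 1 -> 0 < delta < 1 ->
  exists Q, estimator hd Q eps delta /\ Q%:R <= 480 * (eps ^+ 2)^-1 * loglen delta.
Proof.
move=> /andP[e0 e1] hdl; have L1 := loglen_ge1 hdl.
have e2 : 0 < eps ^+ 2 by rewrite exprn_gt0.
have i1 : 1 <= (eps ^+ 2)^-1 by rewrite invf_ge1 // expr_le1 // ltW.
have [|N [N0 N1 N2]] := @exists_nat (80 * (eps ^+ 2)^-1 * loglen delta); first by nra.
exists (3 * N)%N; split; last by rewrite natrM; lra.
apply: direct_estimator => //; apply: expR_loglen => //; first by rewrite ltr0n /= ler_nat.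
rewrite mulrA ler_pdivlMr // -ler_pdivrMr //; lra.
Qed.

(** An estimate this precise can be refined with [8 * 2 ^ k] rounds. *)
Definition precision k : R := (2 * (8 * 2 ^ k)%:R * sd)^-1.

(* Sample-size constants of the initial estimate, of precision [1 / (16 sqrt d)], and of
   a refinement step, of precision [1 / (40 sqrt d)]. *)
Definition refine_scale (K : R) : Prop := 80 * 16 ^+ 2 <= K /\ 20 * 40 ^+ 2 = K.

Section Halving.
Variable K : R.
Hypotheses (K1 : 40 <= K) (K2 : refine_scale K).

(** Each step gives half of [delta] to the earlier estimate and half to the refinement, and halving
    [delta] raises [loglen] by at most 1. The costs double, so these increments stay bounded; the
    offset 2 is the fixed point: [(L + 1 + 2) + (L + 1) = 2 (L + 2)]. *)
Lemma halving_cost k (delta : R) : 0 < delta < 1 ->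
  exists Q, estimator hd Q (precision k) delta /\
    Q%:R <= 64 * K * d%:R * 2 ^+ k * (loglen delta + 2).
Proof.
have D1 := dim_ge1; have sd1 := sqrt_dim_ge1 R hd.
have K1' : 1 <= K by have := K1; lra.
elim: k delta => [|k IH] delta hdl; have L1 := loglen_ge1 hdl; have /andP[d0 d1] := hdl.
  have KD : 1 <= K * d%:R := mulr_ege1 K1' D1.
  have [|N [N0 N1 N2]] := @exists_nat (K * d%:R * loglen delta).
    exact: mulr_ege1.
  exists (3 * N)%N; split; last first.
    rewrite natrM expr0 mulr1.
    have : 0 <= K * d%:R * loglen delta by nra.
    nra.
  have eps0 : 0 < precision 0 by rewrite invr_gt0 !mulr_gt0 //; lra.
  apply: direct_estimator => //; apply: expR_loglen => //; first by rewrite ltr0n /= ler_nat.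
  have -> : precision 0 ^+ 2 / 80 = (80 * 16 ^+ 2 * d%:R)^-1.
    rewrite -(sqrt_dim_sqr R d) /precision muln1.
    by field; rewrite gt_eqF //; lra.
  rewrite ler_pdivlMr; last by nra.
  apply: le_trans N1; rewrite mulrC ler_wpM2r //; first by lra.
  by rewrite ler_wpM2r // K2.1.
have hdl2 : 0 < delta / 2 < 1 by apply/andP; split; lra.
have [Q [estQ Qle]] := IH _ hdl2.
have L2 : loglen (delta / 2) <= loglen delta + 1.
  rewrite /loglen (_ : 8 * d%:R / (delta / 2) = 8 * d%:R / delta * 2); last first.
    by field; rewrite gt_eqF.
  rewrite lnM ?posrE ?divr_gt0 ?mulr_gt0 //; last by lra.
  rewrite lerD2l; have := @le_ln1Dx R 1; rewrite (_ : 1 + 1 = 2 :> R); last by ring.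
  by apply; lra.
have L2' := loglen_ge1 hdl2.
have [|N [N0 N1 N2]] := @exists_nat (K * d%:R * loglen (delta / 2)).
  by rewrite !mulr_ege1.
exists (Q + 4 * N * (8 * 2 ^ k))%N; split.
  have -> : delta = delta / 2 + delta / 2 by field.
  have -> : precision k.+1 = (4 * (8 * 2 ^ k)%:R * sd)^-1.
    by rewrite /precision expnS mulnCA natrM; congr (_^-1); ring.
  apply: refine_estimator => //.
    by rewrite -[X in (X <= _)%N]muln1 leq_mul2l expn_gt0.
  apply: expR_loglen => //; first by rewrite ltr0n /= lexx.
  rewrite K2.2 ler_pdivlMr; last by nra.
  by rewrite mulrC.
rewrite natrD !natrM natrX exprS.
have W0 : 1 <= 2 ^+ k :> R by rewrite exprn_ege1 // ler1n.
move: W0 Qle; move: (2 ^+ k : R) => W W0 Qle.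
move: N1 N2 (mulr_ege1 K1' D1); move ME : (K * d%:R) => M N1 N2 M1.
have MW : 0 <= M * W by nra.
have Q1 : Q%:R <= 64 * (M * W) * (loglen delta + 3).
  apply: (le_trans Qle); have -> : 64 * K * d%:R * W = 64 * (M * W) by rewrite -ME; ring.
  by rewrite ler_wpM2l //; lra.
have N3 : N%:R * W <= 2 * M * (loglen delta + 1) * W.
  rewrite ler_wpM2r //; first by lra.
  apply: (le_trans N2); rewrite -!mulrA ler_wpM2l // ler_wpM2l //; lra.
have -> : 64 * K * d%:R * (2 * W) * (loglen delta + 2) = 128 * (M * W) * (loglen delta + 2).
  by rewrite -ME; ring.
have : 0 <= M * W * (loglen delta - 1) by rewrite mulr_ge0 //; lra.
lra.
Qed.

(** For [eps] at least [1 / (16 sqrt d)] direct estimation suffices, as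
    [1 / eps^2 <= 16 sqrt d / eps]. Otherwise the least sufficient number of halvings is used;
    minimality bounds the number of rounds by a multiple of [1 / (eps sqrt d)]. *)
Lemma iterated_cost (eps delta : R) : 0 < eps <= 1 -> 0 < delta < 1 ->
  exists Q, estimator hd Q eps delta /\
    Q%:R <= 192 * K * (sd / eps) * loglen delta.
Proof.
move=> /andP[e0 e1] hdl; have L1 := loglen_ge1 hdl.
have D1 := dim_ge1; have sd1 := sqrt_dim_ge1 R hd; have K1' := K1.
have sd0 : 0 < sd by lra.
have eL : 0 <= (sd / eps) * loglen delta by rewrite mulr_ge0 ?divr_ge0 //; lra.
case: (leP (precision 0) eps) => h.
  have [|Q [estQ Qle]] := @direct_cost eps delta _ hdl; first by rewrite e0.
  exists Q; split=> //; apply: (le_trans Qle).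
  have : (eps ^+ 2)^-1 <= 16 * (sd / eps).
    rewrite expr2 invfM mulrA ler_pM2r ?invr_gt0 //.
    rewrite -[leRHS]invrK lef_pV2 ?posrE ?invr_gt0 //; last by lra.
    apply: le_trans h; rewrite /precision muln1 lef_pV2 ?posrE; lra.
  move=> h2; have := ler_wpM2r (le_trans ler01 L1) h2.
  have := ler_wpM2r eL K1; lra.
have den k : 0 < 2 * (8 * 2 ^ k)%:R * sd :> R.
  by rewrite !mulr_gt0 // ltr0n muln_gt0 expn_gt0.
pose P k := precision k <= eps.
have exP : exists k, P k.
  have x0 : 0 <= (16 * sd * eps)^-1 by rewrite invr_ge0 !mulr_ge0 //; lra.
  have /andP[_ h2] := truncn_itv x0; set n := (Num.truncn _).+1 in h2.
  exists n; rewrite /P /precision -[leRHS]invrK lef_pV2 ?posrE ?invr_gt0 ?den //.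
  have h3 : n%:R <= 2 ^+ n :> R by rewrite -natrX ler_nat ltnW // ltn_expl.
  have h4 : (16 * sd * eps)^-1 * (16 * sd) = eps^-1 by field; apply/andP; split; rewrite gt_eqF.
  rewrite natrM natrX -h4.
  have : (16 * sd * eps)^-1 <= 2 ^+ n by lra.
  move=> h5; have := ler_wpM2r (_ : 0 <= 16 * sd) h5; lra.
case: (ex_minnP exP) => -[|k] Pk mink; first by rewrite /P leNgt h in Pk.
have nPk : eps < precision k by rewrite ltNge; apply/negP => /mink; rewrite ltnn.
have [Q [estQ Qle]] := halving_cost k.+1 hdl.
exists Q; split; first exact: estimatorW estQ.
apply: (le_trans Qle).
have kk : 2 ^+ k.+1 * sd <= (8 * eps)^-1.
  have : 2 * (8 * 2 ^ k)%:R * sd <= eps^-1.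
    rewrite -[leLHS]invrK lef_pV2 ?posrE ?invr_gt0 ?den //; exact: ltW.
  rewrite natrM natrX exprS invfM => hk; lra.
have kd : d%:R * 2 ^+ k.+1 <= sd / eps * (1 / 8).
  have -> : d%:R * 2 ^+ k.+1 = sd * (2 ^+ k.+1 * sd) by rewrite -{1}(sqrt_dim_sqr R d); ring.
  have -> : sd / eps * (1 / 8) = sd * (8 * eps)^-1 by field; rewrite gt_eqF.
  by rewrite ler_wpM2l // ltW.
have -> : 64 * K * d%:R * 2 ^+ k.+1 = 64 * K * (d%:R * 2 ^+ k.+1) by ring.
apply: (@le_trans _ _ (64 * K * (sd / eps) * (3 * loglen delta))); last by lra.
apply: ler_pM; last by lra.
- by rewrite !mulr_ge0 ?exprn_ge0 //; lra.
- by lra.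
rewrite ler_wpM2l //; first by lra.
have : 0 <= sd / eps by rewrite divr_ge0 //; lra.
lra.
Qed.

End Halving.
End SupNorm.

(** * Dimension one with small success probability *)

Section Guess.
Variables (R : realType) (d : nat) (hd : (0 < d)%N) (m : nat) (m0 : (0 < m)%N).
Local Notation C := R[i].
Local Notation x0 := (Ordinal hd).
Let r0 : 'I_m := Ordinal m0.

Definition uniform_vec : reg d 'I_m -> C :=
  fun s => if s.1 == (ord0, x0) then (((Num.sqrt m%:R)^-1 : R)%:C)%C else 0.

Lemma sum_uniform (f : reg d 'I_m -> R) :
  \sum_s sqn (uniform_vec s) * f s = (\sum_r f ((ord0, x0), r)) / m%:R.
Proof.
rewrite (eq_bigr (fun s => sqn (uniform_vec (s.1, s.2)) * f (s.1, s.2))) => [|[]//].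
rewrite -(pair_bigA _ (fun y r => sqn (uniform_vec (y, r)) * f (y, r))) /=.
rewrite (bigD1 (ord0, x0)) //= [X in _ + X]big1 ?addr0.
  rewrite mulr_suml; apply: eq_bigr => r _.
  by rewrite /uniform_vec eqxx sqnR exprVn sqr_sqrtr // mulrC.
by move=> y /negbTE h; apply: big1 => r _; rewrite /uniform_vec h sqn0 mul0r.
Qed.

Lemma nrm2_uniform : nrm2 uniform_vec = 1.
Proof.
have := sum_uniform (fun=> 1); under eq_bigr => s _ do rewrite mulr1.
rewrite -/(nrm2 _) => ->; rewrite sumr_const card_ord divff //.
by rewrite pnatr_eq0 -lt0n.
Qed.

Definition guess_ops I : seq (op R d I 'I_m) :=
  [:: Gate (fun=> refl (fun s => basis R ((ord0, x0), r0) s - uniform_vec s))].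

Lemma guess_wf I : wf_ops (guess_ops I).
Proof. by split=> // i; exact: isometry_refl. Qed.

Definition guess_expt I : expt R d I 'I_m :=
  @Expt R d I 'I_m 'I_m ((ord0, x0), r0) (guess_ops I) snd (guess_wf I).

Lemma Ex_guess I i U f : Ex (guess_expt I) i U f = (\sum_r f r) / m%:R.
Proof.
rewrite /Ex /amp /run /= refl_basis ?nrm2_uniform //.
exact: (sum_uniform (fun s => f s.2)).
Qed.

End Guess.

Section Arc.
Variable R : realType.
Local Notation C := R[i].

Lemma cell_of (v : R) m : 0 <= v <= m.+1%:R ->
  exists r : 'I_m.+1, r%:R <= v <= r.+1%:R.
Proof.
elim: m => [|m IH] /andP[v0 v1]; first by exists ord0; rewrite v0.
case: (leP v m.+1%:R) => h.
  have [|r hr] := IH; first by rewrite v0.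
  by exists (widen_ord (leqnSn _) r).
by exists ord_max; rewrite /= (ltW h) v1.
Qed.

(** With [|z| <= 9/8], the coordinate [Im (conj z * b)] ranges over [[-9/8 w, 9/8 w]]; the [r]-th of
    [m] equal cells is given by its centre and half-width. *)
Definition in_cell (w : R) (m : nat) (z : C) (r : nat) (b : C) : Prop :=
  sqn b = 1 /\ cabs (z - b) <= w /\
  `|Im (conjc z * b) - (r%:R + 1 / 2 - m%:R / 2) * (9 / 4 * w / m%:R)| <= 9 / 8 * w / m%:R.

Definition candidate (w : R) m z r : C :=
  match pselect (exists b, in_cell w m z r b) with
  | left h => projT1 (cid h)
  | right _ => 0
  end.

Lemma candidateP w m z r b : in_cell w m z r b -> in_cell w m z r (candidate w m z r).
Proof.
move=> h; rewrite /candidate; case: pselect => [h'|]; last by case; exists b.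
exact: (projT2 (cid h')).
Qed.

(* The imaginary part of [conj z * b] is an injective coordinate on the short arc of
   unit numbers close to [z], so cutting its range into [m] cells cuts the arc. *)
Lemma arc_cover (w a : R) m (z b : C) : (0 < m)%N -> 0 < w <= 1 / 8 ->
  6 * w / m%:R <= a -> sqn b = 1 -> cabs (z - b) <= w ->
  exists r : 'I_m, cabs (candidate w m z r - b) <= a.
Proof.
case: m => [//|m] _ /andP[w0 w8] wa b1 zb.
have M0 : 0 < m.+1%:R :> R by rewrite ltr0n.
have cb : cabs b = 1 by rewrite cabs_sqrt b1 sqrtr1.
have zb' : cabs (b - z) <= w by rewrite cabsB.
have zl : 7 / 8 <= cabs z.
  have := cabsD z (b - z); rewrite addrC subrK cb; lra.
have zu : cabs z <= 9 / 8.
  have := cabsD b (z - b); rewrite addrC subrK cb; lra.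
have near (b' : C) : cabs (z - b') <= w ->
    `|Im (conjc z * b')| <= 9 / 8 * w /\ 3 / 5 <= Re (conjc z * b').
  move=> h; have E : conjc z * b' = ((cabs z ^+ 2)%:C)%C + conjc z * (b' - z).
    by rewrite cabs_sqr -conjcMz; ring.
  have q : cabs (conjc z * (b' - z)) <= cabs z * w.
    by rewrite cabsM cabs_sqrt sqnJ -cabs_sqrt cabsB ler_wpM2l // cabs_ge0.
  have qi := le_trans (cabs_Im _) q; have qr := le_trans (cabs_Re _) q.
  rewrite E; move: qi qr; case: (conjc z * (b' - z)) => x y /= qi qr.
  rewrite add0r; split; first by nra.
  move: qr; rewrite ler_norml => /andP[qr _]; nra.
have [ib rb] := near _ zb.
have W0 : 0 < 9 / 4 * w / m.+1%:R by rewrite divr_gt0 //; lra.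
have [|r /andP[r1 r2]] :=
    @cell_of (Im (conjc z * b) / (9 / 4 * w / m.+1%:R) + m.+1%:R / 2) m.
  have : `|Im (conjc z * b) / (9 / 4 * w / m.+1%:R)| <= m.+1%:R / 2.
    rewrite normrM normfV (gtr0_norm W0) ler_pdivrMr //.
    by rewrite (_ : _ * (_ / _) = 9 / 8 * w) //; field; rewrite gt_eqF.
  rewrite ler_norml => /andP[h1 h2]; apply/andP; split; lra.
exists r; have cellb : in_cell w m.+1 z r b.
  split=> //; split=> //.
  move: r1 r2; move vE: (Im _ / _) => v r1 r2.
  have -> : Im (conjc z * b) = v * (9 / 4 * w / m.+1%:R).
    by rewrite -vE divfK // gt_eqF.
  rewrite -mulrBl normrM (gtr0_norm W0).
  have h : `|v - (r%:R + 1 / 2 - m.+1%:R / 2)| <= 1 / 2.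
    rewrite -[r.+1%:R]natr1 in r2; rewrite ler_norml.
    move: r1 r2; move: (m.+1%:R : R) (r%:R : R) => M rr r1 r2; clear -r1 r2.
    by apply/andP; split; lra.
  apply: le_trans (ler_wpM2r (ltW W0) h) _.
  by rewrite (_ : 1 / 2 * _ = 9 / 8 * w / m.+1%:R) //; field; rewrite gt_eqF.
have [c1 [zc ic]] := candidateP cellb.
move: c1 zc ic; move: (candidate w m.+1 z r) => c c1 zc ic.
have [_ [_ icb]] := cellb.
have [jc rc] := near _ zc.
have dy : `|Im (conjc z * c) - Im (conjc z * b)| <= 9 / 4 * w / m.+1%:R.
  rewrite (_ : 9 / 4 * w / m.+1%:R = 9 / 8 * w / m.+1%:R + 9 / 8 * w / m.+1%:R); last first.
    by field; rewrite gt_eqF.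
  apply: (le_trans (ler_distD _ _ _)); apply: lerD ic _.
  by rewrite distrC.
have eqn : sqn (conjc z * c) = sqn (conjc z * b) by rewrite !sqnM c1 b1.
have dz : conjc z * (c - b) = conjc z * c - conjc z * b by rewrite mulrBr.
have : cabs (conjc z * (c - b)) <= 2 * (9 / 4 * w / m.+1%:R).
  rewrite dz; apply: (le_trans (cabs_ReIm _)).
  move: dy eqn ib jc rb rc.
  case: (conjc z * c) => x y; case: (conjc z * b) => x' y'; rewrite /sqn /=.
  move=> dy eqn ib jc rb rc.
  (* On a circle [(x - x') (x + x') = - (y - y') (y + y')]. Real parts of at least 3/5 and small
     imaginary parts let the second coordinate control the first. *)
  have dx : `|x - x'| <= `|y - y'|.
    have E : (x - x') * (x + x') = - (y - y') * (y + y') by lra.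
    have := congr1 Num.norm E; rewrite !normrM normrN.
    have s1 : 6 / 5 <= `|x + x'| by rewrite ger0_norm; lra.
    have s2 : `|y + y'| <= 6 / 5.
      by apply: (le_trans (ler_normD _ _)); lra.
    have := normr_ge0 (x - x'); have := normr_ge0 (y - y'); nra.
  by rewrite [2 * _]mulr_natl mulr2n; exact: (lerD (le_trans dx dy) dy).
rewrite cabsM [cabs (conjc z)]cabs_sqrt sqnJ -cabs_sqrt => h.
(* Dividing by [|z| >= 7/8] gives the factor [36/7], below the 6 of the hypothesis. *)
have : 7 / 8 * cabs (c - b) <= 2 * (9 / 4 * w / m.+1%:R).
  by apply: le_trans h; rewrite ler_wpM2r // cabs_ge0.
have : 0 <= w / m.+1%:R by rewrite divr_ge0 // ltW.
move: wa; rewrite -!mulrA; move: (w / m.+1%:R) (cabs _) => t k; clear; lra.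
Qed.

End Arc.

Section OneDimensional.
Variables (R : realType) (hd : (0 < 1)%N).
Local Notation C := R[i].
Local Notation x0 := (Ordinal hd).

(** The coarse estimate is good with probability at least 1/2, and then at least one of the [m]
    equally likely candidates is correct: success has probability at least [1 / (2 m) >= eta]. *)
Lemma guessing_estimator Q (w a eta : R) m : (0 < m)%N -> 0 < w <= 1 / 8 ->
  6 * w / m%:R <= a -> m%:R * eta <= 1 / 2 ->
  estimator hd Q w (1 / 2) -> estimator hd Q a (1 - eta).
Proof.
move=> m0 w8 wa me [T [X [est [nX hX]]]].
exists _, (bind X (guess_expt R hd m0 _)), (fun (o : T * 'I_m) _ => candidate w m (est o.1 x0) o.2).
split; first by rewrite nq_bind nX /nq /= !addn0.
move=> U Uu; rewrite Ex_bind //.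
have M0 : 0 < m%:R :> R by rewrite ltr0n.
set bad := fun o => ~~ close hd w (est o) U.
apply: (@le_trans _ _ (Ex X tt U (fun o => 1 + (m%:R^-1 * ind (bad o) + - m%:R^-1)))).
  apply: Ex_le => o; rewrite Ex_guess.
  rewrite ler_pdivrMr // mulrDl mulrDl mulrAC mulVf ?gt_eqF // !mul1r mulNr mulVf ?gt_eqF //.
  case: (boolP (bad o)) => [_|].
    rewrite subrr addr0 -[X in _ <= X%:R](card_ord m) -sumr_const.
    by apply: ler_sum => r _; case: (~~ _).
  rewrite negbK => /forallP/(_ x0) ok.
  have U1 : sqn (U x0 x0) = 1.
    by have := sqn_column hd Uu; rewrite big_ord1 (_ : ord0 = x0) //; exact: val_inj.
  have [r hr] := arc_cover m0 w8 wa U1 ok.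
  have g : close hd a (fun=> candidate w m (est o x0) r) U.
    apply/forallP => x; rewrite (_ : x = x0) //; apply: val_inj.
    by case: x => -[].
  rewrite (bigD1 r) //= g /= add0r add0r.
  apply: (@le_trans _ _ (\sum_(j < m | j != r) 1)).
    by apply: ler_sum => j _; case: (~~ _).
  by rewrite sumr_const cardC1 card_ord -subn1 natrB // addrC.
rewrite ExD ExD ExZ !Ex_cst //.
have h := hX U Uu; rewrite -/bad in h.
have i0 : 0 < m%:R^-1 :> R by rewrite invr_gt0.
have h1 : m%:R^-1 * Ex X tt U (fun o => ind (bad o)) <= m%:R^-1 * (1 / 2).
  by rewrite ler_wpM2l // ltW.
have h2 : eta <= m%:R^-1 * (1 / 2) by rewrite ler_pdivlMl // mulrC [m%:R * _]mulrC mulrC.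
lra.
Qed.

(** A success probability of only [eta = 1 - delta] leaves room for about [1 / (2 eta)] candidates,
    so a precision coarser than [eps] by that factor is enough. The resulting [eta / eps] is at most
    [ln (1 / delta) / eps]. *)
Lemma corner_cost (K eps delta : R) :
  40 <= K -> refine_scale K -> 0 < eps < 1 -> 1 / 2 < delta < 1 ->
  exists Q, estimator hd Q eps delta /\
    Q%:R <= 192 * K * loglen 1 (1 / 2 : R) * (8 + 32 * ((1 - delta) / eps)).
Proof.
move=> K40 Ks /andP[e0 e1] /andP[d0 d1].
have [eta [dE [n0 n1]]] : exists eta, delta = 1 - eta /\ 0 < eta /\ eta < 1 / 2.
  by exists (1 - delta); rewrite subKr; do !split; lra.
rewrite dE subKr.
have x1 : 1 <= (2 * eta)^-1 by rewrite invf_ge1; lra.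
have /andP[t1 t2] := truncn_itv (le_trans ler01 x1).
move: (Num.truncn _) t1 t2 => m t1 t2.
have m0 : (0 < m)%N.
  by rewrite -(ltr_nat R) -(ltrD2r 1) add0r natr1; apply: le_lt_trans t2.
have me : m%:R * eta <= 1 / 2.
  have := ler_wpM2r (ltW n0) t1.
  by rewrite (_ : (2 * eta)^-1 * eta = 1 / 2) //; field; rewrite gt_eqF.
have M0 : 0 < m%:R :> R by rewrite ltr0n.
have mi : m%:R^-1 <= 4 * eta.
  rewrite -[leRHS]invrK lef_pV2 ?posrE ?invr_gt0 ?mulr_gt0 //.
  have M1 : 1 <= m%:R :> R by rewrite ler1n.
  have -> : (4 * eta)^-1 = (2 * eta)^-1 / 2 by field; rewrite gt_eqF.
  rewrite -[m.+1%:R]natr1 in t2; lra.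
(* The first term gives [6 w / m <= eps], the second keeps the arc short enough for [arc_cover]. *)
pose w : R := Num.min (eps * m%:R / 8) (1 / 8).
have w0 : 0 < w by rewrite lt_min !divr_gt0 // mulr_gt0.
have w8 : w <= 1 / 8 by rewrite ge_min lexx orbT.
have wm : w <= eps * m%:R / 8 by rewrite ge_min lexx.
have wi : w^-1 <= 8 + 32 * (eta / eps).
  have ee : 0 <= eta / eps by rewrite divr_ge0 // ltW.
  rewrite /w minEle; case: ifP => _; last first.
    by rewrite (_ : (1 / 8)^-1 = 8 :> R); [lra|field].
  have -> : (eps * m%:R / 8)^-1 = 8 * (m%:R^-1 / eps).
    by field; rewrite !gt_eqF.
  have : m%:R^-1 / eps <= 4 * eta / eps by rewrite ler_pM2r // invr_gt0.
  lra.
have [||Q [estQ Qle]] := @iterated_cost R 1 hd K K40 Ks w (1 / 2).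
- by rewrite w0; lra.
- by apply/andP; split; lra.
exists Q; split.
  apply: (guessing_estimator m0 _ _ me estQ); first by rewrite w0.
  have : w / m%:R <= eps / 8 by rewrite ler_pdivrMr // mulrAC.
  lra.
apply: (le_trans Qle); rewrite sqrtr1 (div1r w).
have L1 : 1 <= loglen 1 (1 / 2 : R) by apply: loglen_ge1 => //; apply/andP; split; lra.
rewrite mulrAC; apply: ler_wpM2l; last exact: wi.
by rewrite mulr_ge0 //; lra.
Qed.

End OneDimensional.

(** * Passage to the l_q distance *)

Section LqDistance.
Variables (R : realType) (d : nat) (hd : (0 < d)%N).
Local Notation C := R[i].
Implicit Types (a b : 'I_d -> C) (q : \bar R) (t : R).

Lemma invq_bounds q : (2%:E <= q)%E -> 0 <= invq q <= 1 / 2.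
Proof.
case: q => [r||] //=; last by rewrite lexx /= divr_ge0.
rewrite lee_fin => r2; have r0 : 0 < r by apply: lt_le_trans r2.
rewrite invr_ge0 (ltW r0) /= mul1r.
by rewrite lef_pV2 // posrE.
Qed.

Lemma invq_lt q : (2%:E <= q)%E -> q != 2%:E -> invq q < 1 / 2.
Proof.
case: q => [r||] //= r2 rn2.
rewrite lee_fin in r2; have {}r2 : 2 < r by rewrite lt_neqAle r2 andbT eq_sym -eqe.
rewrite mul1r ltf_pV2 ?posrE //; lra.
Qed.

Lemma lq_dist_sup q a b t : (2%:E <= q)%E -> 0 <= t ->
  (forall j, cabs (a j - b j) <= t) -> lq_dist q a b <= d%:R `^ invq q * t.
Proof.
case: q => [r||] //= r2 t0 h; last first.
  by rewrite powRr0 mul1r; apply: bigmax_le.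
rewrite lee_fin in r2; have r0 : 0 < r by apply: lt_le_trans r2.
have -> : d%:R `^ r^-1 * t = (d%:R * t `^ r) `^ r^-1.
  by rewrite powRM ?powR_ge0 // -powRrM divff ?powRr1 // gt_eqF.
apply: ge0_ler_powR; rewrite ?nnegrE ?invr_ge0 ?(ltW r0) //.
- by apply: sumr_ge0 => j _; exact: powR_ge0.
- by rewrite mulr_ge0 // powR_ge0.
rewrite mulr_natl -[in leRHS](card_ord d) -sumr_const; apply: ler_sum => j _.
by apply: ge0_ler_powR; rewrite ?nnegrE ?cabs_ge0 ?(ltW r0).
Qed.

(** Interpolation between the Euclidean and the sup norm: the sum of [r]-th powers is at most
    [t^(r - 2)] times the sum of squares, hence at most [4 t^(r - 2)], and [4^(1/r) <= 2]. *)
Lemma lq_dist_interp q a b t : (2%:E <= q)%E -> q != 2%:E -> 0 < t ->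
  (forall j, cabs (a j - b j) <= t) -> \sum_j sqn (a j - b j) <= 4 ->
  lq_dist q a b <= 2 * t `^ (1 - 2 * invq q).
Proof.
move=> q2 qn2 t0 h; have := invq_lt q2 qn2.
case: q q2 qn2 => [r||] //= r2 _ ir h4; last first.
  rewrite mulr0 subr0 powRr1 ?(ltW t0) //.
  by apply: bigmax_le => [|j _]; [rewrite mulr_ge0 // ltW|apply: le_trans (h j) _; lra].
rewrite lee_fin in r2; have r0 : 0 < r by apply: lt_le_trans r2.
have s : \sum_j cabs (a j - b j) `^ r <= t `^ (r - 2) * 4.
  apply: (@le_trans _ _ (\sum_j t `^ (r - 2) * sqn (a j - b j))); last first.
    by rewrite -mulr_sumr ler_wpM2l // powR_ge0.
  apply: ler_sum => j _; have [z|nz] := eqVneq (cabs (a j - b j)) 0.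
    by rewrite z powR0 ?gt_eqF // mulr_ge0 ?powR_ge0 ?sqn_ge0.
  have -> : cabs (a j - b j) `^ r = cabs (a j - b j) `^ (r - 2) * sqn (a j - b j).
    rewrite -cabs_sqr -powR_mulrn ?cabs_ge0 // -powRD ?subrK //.
    by rewrite gt_eqF.
  rewrite ler_wpM2r ?sqn_ge0 //.
  by apply: ge0_ler_powR; rewrite ?nnegrE ?cabs_ge0 ?(ltW t0) ?subr_ge0.
apply: (@le_trans _ _ ((t `^ (r - 2) * 4) `^ r^-1)).
  apply: ge0_ler_powR => //; rewrite ?nnegrE ?invr_ge0 ?(ltW r0) //.
    by apply: sumr_ge0 => j _; exact: powR_ge0.
  by rewrite mulr_ge0 ?powR_ge0.
rewrite powRM ?powR_ge0 // -powRrM mulrBl divff ?gt_eqF // mulrC ler_wpM2r ?powR_ge0 //.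
have -> : 4 = 2 `^ 2%:R :> R by rewrite powR_mulrn // expr2 -natrM.
rewrite -powRrM -[leRHS](powRr1 (_ : 0 <= 2)) //; apply: ler_powR; first by lra.
lra.
Qed.

End LqDistance.

(** * Assembly of the two bounds *)

Section Assembly.
Variables (R : realType) (d : nat) (hd : (0 < d)%N).
Local Notation C := R[i].
Local Notation x0 := (Ordinal hd).

Definition achievable (Q : nat) (q : \bar R) (eps delta : R) :=
  exists (k : nat) (A : query_algo R d k), [/\ qnq A = Q,
    forall t : nat, (t <= qnq A)%N -> unitary_op (qV A t) &
    forall U : qop R 'I_d, unitary_op U ->
      1 - delta <= success_prob A U q eps (fun j => U j x0)].

Lemma achievable_estimator Q q (e eps delta : R) (g : ('I_d -> C) -> 'I_d -> C) :
  estimator hd Q e delta ->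
  (forall U b, unitary_op U -> close hd e b U ->
     lq_dist q (fun j => U j x0) (g b) <= eps) ->
  achievable Q q eps delta.
Proof.
move=> [T [X [est [nX hX]]]] hg.
have [k [A [qA uA sA]]] := compile X (fun o => g (est o)).
exists k, A; split=> [|t _|U Uu]; [by rewrite qA|exact: uA|rewrite sA].
rewrite lerBlDr -[leLHS](Ex_cst X tt 1 Uu).
apply: le_trans (lerD (lexx _) (hX U Uu)); rewrite -ExD; apply: Ex_le => o.
case: (boolP (close hd e (est o) U)) => [/(hg _ _ Uu) ->|_] /=.
  by rewrite lerDl.
by rewrite lerDr.
Qed.

(* The default is never reached on a good estimate, since the amplitude vector itself
   is a suitable [b]. *)
Definition ball_round (t : R) (e : 'I_d -> C) : 'I_d -> C :=
  match pselect (exists b : 'I_d -> C,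
      \sum_j sqn (b j) <= 1 /\ forall j, cabs (e j - b j) <= t) with
  | left h => projT1 (cid h)
  | right _ => e
  end.

Lemma ball_roundP (U : qop R 'I_d) t e : unitary_op U -> close hd t e U ->
  \sum_j sqn (ball_round t e j) <= 1 /\ forall j, cabs (e j - ball_round t e j) <= t.
Proof.
move=> Uu /forallP ce; rewrite /ball_round; case: pselect => [h|].
  exact: (projT2 (cid h)).
by case; exists (fun j => U j x0); rewrite sqn_column.
Qed.

Variables (K : R) (q : \bar R) (eps delta : R).
Hypotheses (K40 : 40 <= K) (Ks : refine_scale K).
Hypotheses (q2 : (2%:E <= q)%E) (heps : 0 < eps < 1) (hdelta : 0 < delta < 1).

Lemma achievable_iterated :
  exists Q, achievable Q q eps delta /\
    Q%:R <= 192 * K * (d%:R `^ (2^-1 + invq q) / eps) * loglen d delta.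
Proof.
have /andP[e0 e1] := heps; have D1 := dim_ge1 R hd.
have /andP[i0 i1] := invq_bounds q2.
set w := d%:R `^ invq q.
have w1 : 1 <= w by rewrite -(powRr0 (d%:R : R)); exact: ler_powR.
have w0 : 0 < w by apply: lt_le_trans w1.
have ew : 0 < eps / w <= 1.
  by rewrite divr_gt0 //= ler_pdivrMr // mul1r (le_trans (ltW e1)).
have [Q [estQ Qle]] := iterated_cost hd K40 Ks ew hdelta.
exists Q; split.
  apply: (@achievable_estimator Q q (eps / w) eps delta id estQ) => U b Uu /forallP cb.
  apply: le_trans (lq_dist_sup (t := eps / w) q2 _ _) _.
  - by rewrite divr_ge0 // ltW.
  - by move=> j; rewrite cabsB; exact: cb.
  by rewrite -/w mulrC divfK // gt_eqF.
apply: (le_trans Qle); rewrite powRD ?pnatr_eq0 -?lt0n ?hd ?implybT //.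
rewrite powR12_sqrt // -/w (_ : Num.sqrt d%:R / (eps / w) = Num.sqrt d%:R * w / eps) //.
by rewrite invf_div mulrA.
Qed.

Lemma achievable_direct : q != 2%:E ->
  exists Q, achievable Q q eps delta /\
    Q%:R <= 192 * K * ((3 / eps) `^ ((2^-1 - invq q)^-1)) * loglen d delta.
Proof.
move=> qn2; have /andP[e0 e1] := heps; have /andP[i0 _] := invq_bounds q2.
have il := invq_lt q2 qn2; have L1 := loglen_ge1 hd hdelta.
set p := 1 - 2 * invq q; have p0 : 0 < p by rewrite /p; lra.
(* Chosen so that [2 t^p = 2 eps / 3], while [1 / t^2] is exactly the first term of the minimum. *)
set t := (eps / 3) `^ p^-1.
have t0 : 0 < t by rewrite powR_gt0 // divr_gt0.
have t1 : t <= 1.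
  have one : 1 `^ p^-1 = 1 :> R by rewrite powR1.
  rewrite -[leRHS]one; apply: ge0_ler_powR; rewrite ?nnegrE ?invr_ge0 ?(ltW p0) //.
    by rewrite divr_ge0 // ltW.
  by lra.
have th : 0 < t / 2 <= 1 by apply/andP; split; lra.
(* Precision [t / 2], because [ball_round] may move the estimate by as much again. *)
have [Q [estQ Qle]] := direct_cost hd th hdelta.
exists Q; split.
  apply: (@achievable_estimator Q q (t / 2) eps delta (ball_round (t / 2)) estQ) => U b Uu cb.
  have [b1 bt] := ball_roundP Uu cb.
  apply: le_trans (lq_dist_interp q2 qn2 t0 _ _) _.
  - move=> j; rewrite (_ : U j x0 - _ = (U j x0 - b j) + (b j - ball_round (t / 2) b j)).
      apply: (le_trans (cabsD _ _)).
      by have := bt j; move/forallP: cb => /(_ j); rewrite cabsB; lra.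
    by rewrite addrA subrK.
  - apply: (@le_trans _ _ (\sum_j (2 * sqn (U j x0) + 2 * sqn (ball_round (t / 2) b j)))).
      by apply: ler_sum => j _; rewrite -[sqn (ball_round _ _ _)]sqnN; exact: sqnD_le.
    by rewrite big_split /= -!mulr_sumr sqn_column //; lra.
  rewrite -/p /t -powRrM mulVf ?gt_eqF // powRr1; last by rewrite divr_ge0 // ltW.
  by lra.
apply: (le_trans Qle); rewrite ler_wpM2r //; first by lra.
have -> : (3 / eps) `^ (2^-1 - invq q)^-1 = (t ^+ 2)^-1.
  have -> : (2^-1 - invq q)^-1 = p^-1 * 2%:R.
    have -> : 2^-1 - invq q = p / 2 by rewrite /p; field.
    by rewrite invf_div mulrC.
  rewrite powRrM powR_mulrn ?powR_ge0 // -exprVn; congr (_ ^+ 2).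
  have tx : t * (3 / eps) `^ p^-1 = 1.
    rewrite -powRM ?divr_ge0 ?(ltW e0) // (_ : eps / 3 * (3 / eps) = 1) ?powR1 //.
    by field; rewrite gt_eqF.
  by apply: (mulfI (_ : t != 0)); rewrite ?tx ?divff ?gt_eqF.
have -> : 480 * ((t / 2) ^+ 2)^-1 = 480 * 4 * (t ^+ 2)^-1.
  by field; rewrite gt_eqF.
by rewrite ler_wpM2r ?invr_ge0 ?sqr_ge0 //; have := K40; lra.
Qed.

End Assembly.

Theorem mainTheorem7 (R : realType) :
  exists Cst : R, 0 < Cst /\
  forall (d : nat) (hd : (0 < d)%N) (q : \bar R) (eps delta : R),
    (2%:E <= q)%E -> 0 < eps < 1 -> 0 < delta < 1 ->
    exists (k : nat) (A : query_algo R d k),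
      (qnq A)%:R <= Cst * (1 + query_bound d q eps delta) /\
      (forall t : nat, (t <= qnq A)%N -> unitary_op (qV A t)) /\
      forall U : qop R 'I_d,
        unitary_op U ->
        1 - delta <= success_prob A U q eps (fun j => U j (Ordinal hd)).
Proof.
have [K [K40 Ks]] : exists K : R, 40 <= K /\ refine_scale K.
  exists (20 * 40 ^+ 2); split; last split=> //.
    by rewrite expr2 mulrA ler_peMl // -natrM ler1n.
  have -> : 80 * 16 ^+ 2 = 20 * 32 ^+ 2 :> R by ring.
  by rewrite ler_wpM2l // lerXn2r ?nnegrE // ler_nat.
set L1 : R := loglen 1 (1 / 2).
have L1ge : 1 <= L1 by apply: loglen_ge1 => //; apply/andP; split; lra.
(* The summand 4 is for [d / delta >= 2], the summand [32 * L1] for [d = 1] with [delta > 1/2]. *)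
exists (192 * K * (4 + 32 * L1)); split; first by rewrite !mulr_gt0 //; lra.
move=> d hd q eps delta q2 heps hdelta.
suff [Q [[k [A [qA uA sA]]] Qle]] : exists Q, achievable hd Q q eps delta /\
    Q%:R <= 192 * K * (4 + 32 * L1) * (1 + query_bound d q eps delta).
  by exists k, A; rewrite qA in uA *.
have /andP[e0 e1] := heps; have /andP[d0 d1] := hdelta.
have D1 := dim_ge1 R hd.
have dd : 1 <= d%:R / delta by rewrite ler_pdivlMr //; lra.
have l0 : 0 <= ln (d%:R / delta) by exact: ln_ge0.
set t2 := d%:R `^ (2^-1 + invq q) / eps.
set t1 := (3 / eps) `^ (2^-1 - invq q)^-1.
pose m := if q == 2%:E then t2 else Num.min t1 t2.
have bE : query_bound d q eps delta = m * ln (d%:R / delta) by [].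
have /andP[i0 i1] := invq_bounds q2.
have m0 : 0 <= m.
  by rewrite /m; case: ifP => _; rewrite ?le_min ?powR_ge0 ?divr_ge0 ?powR_ge0 // ltW.
have [small|large] := boolP ((d == 1%N) && (1 / 2 < delta)).
  have /andP[/eqP d_1 dh] := small; subst d.
  have [|Q [estQ Qle]] := @corner_cost R hd K eps delta K40 Ks heps; first by rewrite dh.
  exists Q; split.
    apply: (achievable_estimator (g := id) estQ) => U b Uu /forallP cb.
    apply: le_trans (lq_dist_sup (t := eps) q2 (ltW e0) _) _.
      by move=> j; rewrite cabsB; exact: cb.
    by rewrite powR1 mul1r.
  apply: (le_trans Qle); rewrite -/L1 bE div1r lnV ?posrE //.
  have lnd : 1 - delta <= - ln delta.
    have := @le_ln1Dx R (delta - 1).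
    rewrite (_ : 1 + (delta - 1) = delta); last by ring.
    move=> h.
    have : ln delta <= delta - 1 by apply: h; lra.
    lra.
  (* At [d = 1] the second term is [1 / eps], and the first is a power of [3 / eps >= 1] with
     exponent at least 1. *)
  have me : eps^-1 <= m.
    have t2e : t2 = eps^-1 by rewrite /t2 powR1 mul1r.
    rewrite /m t2e; case: ifP => [//|/negbT qn2]; rewrite le_min lexx andbT.
    have il := invq_lt q2 qn2.
    have b1 : 1 <= 3 / eps by rewrite ler_pdivlMr //; lra.
    apply: (@le_trans _ _ (3 / eps)).
      by rewrite -[leLHS]mul1r ler_wpM2r ?invr_ge0 ?(ltW e0) //; lra.
    apply: le1r_powR => //; rewrite invf_ge1; lra.
  have h : (1 - delta) / eps <= m * - ln delta.
    by rewrite mulrC ler_pM ?invr_ge0 ?(ltW e0) //; lra.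
  have KL : 0 <= 192 * K * L1 by rewrite !mulr_ge0 //; lra.
  have h0 : 0 <= (1 - delta) / eps by rewrite divr_ge0 ?(ltW e0) //; lra.
  have K0 : 0 <= 192 * K by lra.
  (* The constant part 8 of the cost goes into the additive 1; the logarithm tends to 0 as [delta]
     tends to 1. *)
  apply: (@le_trans _ _ (192 * K * (32 * L1) * (1 + m * - ln delta))).
    have -> : 192 * K * (32 * L1) * (1 + m * - ln delta) =
      192 * K * L1 * (32 + 32 * (m * - ln delta)) by ring.
    by rewrite ler_wpM2l //; lra.
  rewrite ler_wpM2r //; first by lra.
  by rewrite ler_wpM2l //; lra.
have dd2 : 2 <= d%:R / delta.
  rewrite ler_pdivlMr //; move: large; rewrite negb_and -leNgt => /orP[dn|dl]; last by lra.
  have : 2 <= d%:R :> R by rewrite ler_nat ltn_neqAle eq_sym dn.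
  lra.
(* For [x >= 2] one has [8 x <= x^4]. *)
have LL : loglen d delta <= 4 * ln (d%:R / delta).
  rewrite /loglen -mulrA; move: dd2; move: (d%:R / delta) => x x2.
  rewrite [leRHS]mulr_natl -lnXn; last by lra.
  rewrite ler_ln ?posrE ?mulr_gt0 ?exprn_gt0 //; try lra.
  rewrite exprS mulrC ler_wpM2l //; first by lra.
  have -> : 8 = 2 ^+ 3 :> R by rewrite -natrX.
  by rewrite lerXn2r // nnegrE; lra.
have [Q [aQ Qle]] : exists Q, achievable hd Q q eps delta /\
    Q%:R <= 192 * K * m * loglen d delta.
  rewrite /m; case: ifP => [_|/negbT qn2]; first exact: achievable_iterated.
  rewrite minEle; case: ifP => _; first exact: achievable_direct.
  exact: achievable_iterated.
exists Q; split=> //; apply: (le_trans Qle); rewrite bE.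
have K0 : 0 <= 192 * K by lra.
have Km : 0 <= 192 * K * m by rewrite mulr_ge0.
apply: le_trans (ler_wpM2l Km LL) _.
have ml : 0 <= m * ln (d%:R / delta) by rewrite mulr_ge0.
rewrite -!mulrA; rewrite ler_wpM2l // ler_wpM2l //; first by lra.
nra.
Qed.
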